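(* Let $F:\mathbb{R}_{\ge 0}\to\mathbb{R}$ be an increasing function such that $$\int_{B(0,1)}\big|F(|c_1(\alpha)|)\big|^2\,d\mu<\infty.$$ For any natural number $n$ and non-negative real numbers $d_1,\dots,d_n$, let the generalized average be defined as $$M_{F,n}(d_1,\dots,d_n)=F^{-1}\left(\frac{F(d_1)+\cdots+F(d_n)}{n}\right).$$ If $(a_n)_{n=1}^\infty$ is an $L^2$-good universal sequence of natural numbers such that $(a_n\theta)_{n=1}^\infty$ is uniformly distributed modulo $1$ for any irrational number $\theta$, then $$\lim_{n\to\infty}M_{F,n}\big(|c_{a_1}(\alpha)|,\dots,|c_{a_n}(\alpha)|\big)=F^{-1}\left(\int_{B(0,1)}F(|c_1(\alpha)|)\,d\mu\right)$$ for $\mu$-almost every $\alpha\in B(0,1)$.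
   Context: Let $p$ be a prime and let $K$ be a finite extension of $\mathbb{Q}_p$ of degree $m$, with ramification index $e$ and residue degree $f$ (so $m=ef$). Let $|\cdot|$ be the unique extension to $K$ of the $p$-adic absolute value with $|p|=p^{-1}$. Let $L\subseteq K$ be the unramified subextension of degree $f$ over $\mathbb{Q}_p$, write $L=\mathbb{Q}_p(\gamma)$ with $\gamma$ a primitive $(p^f-1)$-th root of unity, and fix $\beta\in K$ with $K=L(\beta)$ and $|\beta|=p^{1/e}$. For $b=\sum_{j\ge n_0}a_jp^j\in\mathbb{Q}_p$ with digits $a_j\in\{0,1,\dots,p-1\}$ put $\lfloor b\rfloor_p=\sum_{n_0\le j\le 0}a_jp^j$ (which is $0$ if $|b|<1$). Every $\alpha\in K$ is uniquely $\alpha=\sum_{i=0}^{e-1}\sum_{j=0}^{f-1}b_{i,j}\gamma^j\beta^i$ with $b_{i,j}\in\mathbb{Q}_p$, and $\lfloor\alpha\rfloor=\sum_{i=0}^{e-1}\sum_{j=0}^{f-1}\lfloor b_{i,j}\rfloor_p\gamma^j\beta^i$. Let $B(0,1)=\{x\in K:|x|<1\}$, and let $\mu$ be the restriction to $B(0,1)$ (with its Borel $\sigma$-algebra) of the Haar measure of the additive group $K$, normalized by $\mu(B(0,1))=1$. The continued fraction map $T:B(0,1)\to B(0,1)$ is $T(\alpha)=\frac1\alpha-\left\lfloor\frac1\alpha\right\rfloor$ for $\alpha\ne 0$ and $T(0)=0$. The $n$-th partial quotient of $\alpha\in B(0,1)$ is $c_n(\alpha)=\lfloor 1/T^{n-1}(\alpha)\rfloor$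 for $n\ge 1$, defined when $T^{n-1}(\alpha)\neq 0$ (so all $c_n(\alpha)$ are defined for $\mu$-almost every $\alpha$). A strictly increasing sequence of positive integers $(a_n)_{n\ge1}$ is $L^2$-good universal if for each measure-preserving dynamical system $(X,\mathcal{C},\nu,S)$ on a probability space and each $g\in L^2(X,\mathcal{C},\nu)$ the limit $\lim_{n\to\infty}\frac1n\sum_{j=1}^n g(S^{a_j-1}x)$ exists for $\nu$-almost every $x$. A real sequence $(x_n)_{n\ge1}$ is uniformly distributed modulo $1$ if for each interval $I\subseteq[0,1)$, $\lim_{n\to\infty}\frac1n\#\{1\le j\le n:\{x_j\}\in I\}$ equals the length of $I$, where $\{x_j\}$ is the fractional part. $F^{-1}$ denotes the inverse function of $F$.
   Formalization: F is taken strictly increasing, and every average (F(d_1)+...+F(d_n))/n with d_i >= 0 is assumed to lie in the range of F (equivalently F is continuous), since otherwise F^{-1} and the generalized averages M_{F,n} are not defined. *)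

(* Defs.v *)
From HB Require Import structures.
From mathcomp Require Import all_boot all_order all_algebra all_field.
From mathcomp Require Import all_classical all_reals all_analysis.

Set Implicit Arguments.
Unset Strict Implicit.
Unset Printing Implicit Defensive.

Import Order.TTheory GRing.Theory Num.Theory.
Import numFieldNormedType.Exports.

Local Open Scope classical_set_scope.
Local Open Scope ring_scope.

(* MathComp's own norm cannot carry a non-archimedean absolute value: its
   axioms force `|x *+ n| = `|x| *+ n. *)
Record absval (K : fieldType) (R : realType) := AbsVal {
  absval_fun :> K -> R;
  absval_ge0 : forall x, 0 <= absval_fun x;
  absval_eq0 : forall x, (absval_fun x == 0) = (x == 0);
  absvalM : forall x y, absval_fun (x * y) = absval_fun x * absval_fun y;
  absvalD : forall x y, absval_fun (x + y) <= absval_fun x + absval_fun y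
}.

(* Alias of K carrying the metric |x - y|. *)
Definition valued (K : fieldType) (R : realType) (v : absval K R) : Type := K.

Section ValuedMetric.
Context (K : fieldType) (R : realType) (v : absval K R).

Let dist (x y : K) : R := v (x - y).

Let distxx (x : K) : dist x x = 0.
Proof. by apply/eqP; rewrite /dist absval_eq0 subrr. Qed.

Let dist_positivity (x y : K) : dist x y = 0 -> x = y.
Proof. by move=> /eqP; rewrite /dist absval_eq0 subr_eq0 => /eqP. Qed.

Let dist_sym (x y : K) : dist x y = dist y x.
Proof.
have vN1 : v (-1) = 1.
  have v1 : v 1 = 1.
    by apply: (@mulfI R (v 1)); rewrite ?absval_eq0 ?oner_eq0// -absvalM !mulr1.
  have : v (-1) ^+ 2 == 1 by rewrite expr2 -absvalM mulrNN mulr1 v1.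
  by rewrite sqrp_eq1 ?absval_ge0// => /eqP.
by rewrite /dist -opprB -mulN1r absvalM vN1 mul1r.
Qed.

Let dist_triangle (y x z : K) : dist x z <= dist x y + dist y z.
Proof. by rewrite /dist -(subrKA y) absvalD. Qed.

HB.instance Definition _ := Choice.copy (valued v) K.
HB.instance Definition _ := isPointed.Build (valued v) (0 : K).
HB.instance Definition _ :=
  @isMetric.Build R (valued v) dist distxx dist_positivity dist_sym
    dist_triangle.

End ValuedMetric.

Notation borel v := (g_sigma_algebraType (@open (valued v))).

Definition unit_ball (K : fieldType) (R : realType) (v : absval K R) : set K :=
  [set x | v x < 1].

(* (Qp, vQ) is the completion of the rationals for the p-adic absolute value;
   the clause on positive naturals fixes vQ on all of rat, and makes Qp of
   characteristic 0, so that ratr is an embedding. *)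
Definition is_padic_field (p : nat) (Qp : fieldType) (R : realType)
    (vQ : absval Qp R) : Prop :=
  [/\ forall n : nat, (0 < n)%N -> vQ n%:R = p%:R ^- logn p n,
      forall F : set_system (valued vQ), ProperFilter F -> cauchy F -> cvg F &
      dense (range (ratr : rat -> Qp) : set (valued vQ))].

Section LocalField.
Context (Qp : fieldType) (R : realType) (vQ : absval Qp R).
Context (K : fieldExtType Qp) (v : absval K R).

(* The value group |Qp^*| has index e in |E^*|: the |t i| are coset
   representatives. *)
Definition ramification_index (E : {subfield K}) (e : nat) : Prop :=
  exists t : 'I_e -> K,
    (forall i, t i \in E /\ t i != 0) /\
    (forall x, x \in E -> x != 0 ->
      exists! i, exists c : Qp, v x = vQ c * v (t i)).

(* The residue field O_K / m_K has dimension f over the residue field of Qp: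
   the classes of the t i form a basis. *)
Definition residue_degree (f : nat) : Prop :=
  exists t : 'I_f -> K,
    [/\ forall i, v (t i) <= 1,
        forall x : K, v x <= 1 -> exists c : 'I_f -> Qp,
          (forall i, vQ (c i) <= 1) /\ v (x - \sum_i c i *: t i) < 1 &
        forall c : 'I_f -> Qp, (forall i, vQ (c i) <= 1) ->
          v (\sum_i c i *: t i) < 1 -> forall i, vQ (c i) < 1].

Definition unramified (E : {subfield K}) : Prop := ramification_index E 1.

(* K being second countable and locally compact, regularity is automatic. *)
Definition is_haar (mu : {measure set (borel v) -> \bar R}) : Prop :=
  [/\ forall (x : K) (A : set (borel v)), measurable A ->
        mu [set (x + y : K) | y in (A : set K)] = mu A,
      forall C : set (valued v), compact C -> (mu C < +oo)%E &
      forall U : set (valued v), open U -> U !=set0 -> (0 < mu U)%E].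

End LocalField.

Section ContinuedFraction.
Context (p : nat) (Qp : fieldType) (R : realType) (vQ : absval Qp R).

Definition digit_sum (N : nat) (a : nat -> nat) (n : nat) : Qp :=
  \sum_(0 <= k < n) (a k)%:R * p%:R ^ (k%:Z - N%:Z).

(* The expansion b = sum_(j >= -N) a_j p^j is indexed by k = j + N, so that
   j <= 0 means k < N.+1; expansions starting at a positive index are padded
   with zeros. *)
Definition padic_floor (b : Qp) : Qp :=
  xget 0 [set c | exists (N : nat) (a : nat -> nat),
    [/\ forall k, (a k < p)%N,
        vQ (b - digit_sum N a n) @[n --> \oo] --> (0 : R) &
        c = digit_sum N a N.+1]].

Context (K : fieldExtType Qp) (e f : nat) (gamma beta : K).

Definition gb_sum (b : 'M[Qp]_(e, f)) : K :=
  \sum_(i < e) \sum_(j < f) b i j *: (gamma ^+ j * beta ^+ i).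

Definition field_floor (alpha : K) : K :=
  xget 0 [set y | exists b : 'M[Qp]_(e, f),
    alpha = gb_sum b /\ y = gb_sum (map_mx padic_floor b)].

Definition cf_map (alpha : K) : K :=
  if alpha == 0 then 0 else alpha^-1 - field_floor alpha^-1.

(* Indexed from n = 1. When cf_map^(n-1) alpha = 0, where the partial quotient
   is undefined, this takes the junk value field_floor 0. *)
Definition partial_quotient (n : nat) (alpha : K) : K :=
  field_floor (iter n.-1 cf_map alpha)^-1.

End ContinuedFraction.

Section UniformDistribution.
Context (R : realType).

(* Sequences are indexed from 1; a 0 is irrelevant. *)
Definition increasing_pos_seq (a : nat -> nat) : Prop :=
  (forall n, (1 <= n)%N -> (0 < a n)%N) /\
  (forall m n, (1 <= m)%N -> (m < n)%N -> (a m < a n)%N).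

Definition L2_good_universal (a : nat -> nat) : Prop :=
  increasing_pos_seq a /\
  forall (d : measure_display) (X : measurableType d) (nu : probability X R)
    (S : X -> X),
    measurable_fun [set: X] S ->
    (forall A : set X, measurable A -> nu (S @^-1` A) = nu A) ->
    forall g : {mfun X >-> R}, finite_norm nu 2%:E g ->
    {ae nu, forall x,
      cvgn (fun n => (\sum_(1 <= j < n.+1) g (iter (a j).-1 S x)) / n%:R)}.

Definition frac_part (x : R) : R := x - (Num.floor x)%:~R.

Definition unif_distr_mod1 (x : nat -> R) : Prop :=
  forall I : interval R, [set` I] `<=` `[0, 1[%classic ->
    (count (fun j => frac_part (x j) \in I) (iota 1 n))%:R / n%:R
      @[n --> \oo] --> fine (lebesgue_measure [set` I]).

Definition nonneg_reals : set R := [set x | 0 <= x].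

Definition average (F : R -> R) (n : nat) (d : nat -> R) : R :=
  (\sum_(1 <= j < n.+1) F (d j)) / n%:R.

(* The inverse function of F on the nonnegative reals; it is only meaningful on
   the image F @` nonneg_reals. *)
Definition inverse_fun (F : R -> R) : R -> R :=
  'pinv_(fun=> 0) nonneg_reals F.

Definition generalized_average (F : R -> R) (n : nat) (d : nat -> R) : R :=
  inverse_fun F (average F n d).

(* The arguments of F^-1 in the generalized averages lie in its domain, i.e.
   all generalized averages exist. For strictly increasing F this amounts to
   continuity of F. *)
Definition generalized_average_defined (F : R -> R) : Prop :=
  forall (n : nat) (d : nat -> R), (0 < n)%N ->
    (forall j, 0 <= d j) -> (F @` nonneg_reals) (average F n d).

End UniformDistribution.

(* Main.v *)
(* The norm of [K] is the maximum norm in the basis [gamma^j beta^i], so [K] is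
   the disjoint union of the translates of the open unit ball by the values of
   the floor. Hence the continued fraction map [T] sends each set
   [c_1 = c], consisting of the [1 / (c + y)] with [v y < 1], bijectively onto
   the unit ball, and it maps balls to balls multiplying radii by [v c ^ 2]. By
   uniqueness of measures this gives
   [mu (c_1 = c, T in B) = mu (c_1 = c) * mu B]: [T] preserves [mu] and the
   partial quotients are independent and identically distributed. The averages
   of [F |c_(a_j)|], which converge almost everywhere because [a] is good
   universal, therefore have variance [sigma^2 / n], and Fatou's lemma
   identifies their limit as the mean. Finally [F] is continuous since its image
   contains all averages, so that [F^-1] passes to the limit. *)

Require Import Defs.
From HB Require Import structures.
From mathcomp Require Import all_boot all_order all_algebra all_field.
From mathcomp Require Import all_classical all_reals all_analysis.
From mathcomp Require Import measurable_realfun.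
From mathcomp Require Import zify ring lra.

Set Implicit Arguments.
Unset Strict Implicit.
Unset Printing Implicit Defensive.

Import Order.TTheory GRing.Theory Num.Theory.
Import numFieldNormedType.Exports.

Local Open Scope classical_set_scope.
Local Open Scope ring_scope.

(** The norm is the weighted maximum of [vQ (b i j) * v beta ^+ i]. Residue classes separate the
    indices [j], value classes modulo the value group of [Qp] separate the indices [i], and both are
    handled by counting instead of quotients: the hypotheses provide [p ^ f] classes of the first
    kind and [e] of the second. The weights lie in [[1, p)] and the nonzero values of [vQ] are
    powers of [p], so the weights do not affect whether a sum has value below 1. This is what makes
    a coordinatewise floor a choice of representatives for the cosets of the open unit ball.

    The measure of a ball is never computed. What is needed is that it is multiplicative in the
    radius, because inversion scales the balls inside [c_1 = c]; this follows from translation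
    invariance by comparing partitions into cosets. *)

(** * Absolute values and the ultrametric inequality *)

Section AbsoluteValue.
Context (K : fieldType) (R : realType) (v : absval K R).
Implicit Types (x y z : K) (r : R).

Lemma absval0 : v 0 = 0.
Proof. by apply/eqP; rewrite absval_eq0. Qed.

Lemma absval1 : v 1 = 1.
Proof. by apply: (@mulfI R (v 1)); rewrite ?absval_eq0 ?oner_eq0// -absvalM !mulr1. Qed.

Lemma absval_gt0 x : (0 < v x) = (x != 0).
Proof. by rewrite lt_def absval_ge0 andbT absval_eq0. Qed.

Lemma absvalN x : v (- x) = v x.
Proof.
rewrite -mulN1r absvalM; suff -> : v (-1) = 1 by rewrite mul1r.
have : v (-1) ^+ 2 == 1 by rewrite expr2 -absvalM mulrNN mulr1 absval1.
by rewrite sqrp_eq1 ?absval_ge0// => /eqP.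
Qed.

Lemma absvalB x y : v (x - y) = v (y - x).
Proof. by rewrite -opprB absvalN. Qed.

Lemma absvalV x : v x^-1 = (v x)^-1.
Proof.
have [->|x0] := eqVneq x 0; first by rewrite invr0 absval0 invr0.
by apply: (@mulfI R (v x)); rewrite ?absval_eq0// -absvalM !mulfV ?absval_eq0 ?absval1.
Qed.

Lemma absvalX x n : v (x ^+ n) = v x ^+ n.
Proof. by elim: n => [|n IH]; rewrite ?expr0 ?absval1// !exprS absvalM IH. Qed.

Lemma absvalXz x (n : int) : v (x ^ n) = v x ^ n.
Proof. by case: n => n; rewrite ?NegzE -?exprnP -?exprnN ?absvalV absvalX. Qed.

Definition ultrametric := forall x y, v (x + y) <= Num.max (v x) (v y).

(* If [v x, v y <= M], expanding [(x + y)^n] gives [v (x + y)^n <= (n + 1) M^n];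
   take n-th roots, in the form of Bernoulli's inequality. *)
Lemma absval_nat_ultrametric : (forall n : nat, v n%:R <= 1) -> ultrametric.
Proof.
move=> vn x y; set M := Num.max _ _.
have M0 : 0 <= M by rewrite le_max absval_ge0.
have powB n : v (x + y) ^+ n <= M ^+ n *+ n.+1.
  rewrite -absvalX exprDn.
  have -> : M ^+ n *+ n.+1 = \sum_(i < n.+1) M ^+ n by rewrite sumr_const card_ord.
  elim/big_ind2 : _ => [|a b c d ab cd|i _]; first by rewrite absval0.
    exact: le_trans (absvalD _ _ _) (lerD ab cd).
  rewrite -mulr_natr !absvalM !absvalX -[leRHS]mulr1 ler_pM ?vn ?mulr_ge0 ?exprn_ge0 ?absval_ge0//.
  have -> : M ^+ n = M ^+ (n - i) * M ^+ i by rewrite -exprD subnK// leq_ord.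
  by apply: ler_pM; rewrite ?exprn_ge0 ?absval_ge0//;
    apply: lerXn2r; rewrite ?nnegrE ?absval_ge0// le_max lexx ?orbT.
rewrite leNgt; apply/negP => Mlt.
have [M00|Mn0] := eqVneq M 0.
  by have := powB 1%N; rewrite !expr1 M00 mul0rn leNgt -M00 Mlt.
have Mgt0 : 0 < M by rewrite lt_def Mn0.
pose h := v (x + y) / M - 1.
have h0 : 0 < h by rewrite subr_gt0 ltr_pdivlMr ?mul1r.
have hE : 1 + h = v (x + y) / M by rewrite /h subrKC.
clearbody h.
(* The linear term of the expansion would grow no faster than [n.+1], hence the quadratic one. *)
have bernoulli n : h ^+ 2 *+ 'C(n, 2) <= (1 + h) ^+ n.
  rewrite exprDn; have [n2|n2] := ltnP n 2.
    rewrite bin_small// mulr0n; apply: sumr_ge0 => i _.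
    by rewrite expr1n mul1r mulrn_wge0// exprn_ge0// ltW.
  rewrite (bigD1 (Ordinal (n2 : 2 < n.+1)%N))//= expr1n mul1r lerDl; apply: sumr_ge0 => i _.
  by rewrite expr1n mul1r mulrn_wge0// exprn_ge0// ltW.
have bnd n : h ^+ 2 *+ 'C(n, 2) <= n.+1%:R.
  apply: le_trans (bernoulli n) _; rewrite hE expr_div_n ler_pdivrMr ?exprn_gt0//.
  by rewrite mulr_natl.
(* With [N - 1 > 4 / h ^+ 2], the left side of [bnd N] exceeds [2 * N], hence [N + 1]. *)
have c0 : 0 <= 4 / h ^+ 2 + 1 by rewrite addr_ge0 ?divr_ge0 ?sqr_ge0.
have := archi_boundP c0; set N := Num.bound _ => HN.
have N1 : (1 <= N)%N.
  by rewrite lt0n; apply/negP => /eqP N0; move: HN; rewrite N0 ltNge c0.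
have := bnd N; apply/negP; rewrite -ltNge.
have e2 : ('C(N, 2))%:R * 2 = N%:R * (N%:R - 1) :> R.
  by rewrite -natrM -(natrB _ N1) -natrM mulnC mul_bin_left bin1 mulnC.
rewrite -mulr_natr.
have h2 : 0 < h ^+ 2 by rewrite exprn_gt0.
have : 4 < (N%:R - 1) * h ^+ 2 by rewrite -ltr_pdivrMr// ltrBrDr.
have : 1 <= N%:R :> R by rewrite ler1n.
move: e2 h2; set b := ('C(N, 2))%:R; set q := h ^+ 2; rewrite -natr1; set m := N%:R.
move=> e2 q0 m1 mq.
nra.
Qed.

End AbsoluteValue.

(** * Sums under the ultrametric inequality *)

Section Ultrametric.
Context (K : fieldType) (R : realType) (v : absval K R) (vU : ultrametric v).
Implicit Types (x y z : K) (r : R).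

Lemma ultra_le x y r : v x <= r -> v y <= r -> v (x + y) <= r.
Proof. by move=> xr yr; apply: le_trans (vU _ _) _; rewrite ge_max xr. Qed.

Lemma ultra_lt x y r : v x < r -> v y < r -> v (x + y) < r.
Proof. by move=> xr yr; apply: le_lt_trans (vU _ _) _; rewrite gt_max xr. Qed.

Lemma ultra_leB x y r : v x <= r -> v y <= r -> v (x - y) <= r.
Proof. by move=> xr yr; apply: ultra_le; rewrite ?absvalN. Qed.

Lemma ultra_ltB x y r : v x < r -> v y < r -> v (x - y) < r.
Proof. by move=> xr yr; apply: ultra_lt; rewrite ?absvalN. Qed.

Lemma ultra_eq x y : v (x - y) < v x -> v y = v x.
Proof.
move=> xy; apply/eqP; rewrite eq_le; apply/andP; split.
  rewrite -[y in leLHS](subrKC x); apply: ultra_le => //.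
  by rewrite absvalB ltW.
rewrite leNgt; apply/negP => yx.
have : v (x - y + y) < v x by exact: ultra_lt.
by rewrite subrK ltxx.
Qed.

Lemma ultra_sum_le (I : Type) (s : seq I) (P : pred I) (F : I -> K) r :
  0 <= r -> (forall i, P i -> v (F i) <= r) -> v (\sum_(i <- s | P i) F i) <= r.
Proof.
by move=> r0 Fr; elim/big_ind: _ => //; [rewrite absval0|move=> x y; exact: ultra_le].
Qed.

Lemma ultra_sum_lt (I : Type) (s : seq I) (P : pred I) (F : I -> K) r :
  0 < r -> (forall i, P i -> v (F i) < r) -> v (\sum_(i <- s | P i) F i) < r.
Proof.
by move=> r0 Fr; elim/big_ind: _ => //; [rewrite absval0|move=> x y; exact: ultra_lt].
Qed.

(* The largest term of the sum is unique, hence dominates strictly. *)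
Lemma ultra_sum_distinct (I : finType) (F : I -> K) :
  (forall i j, F i != 0 -> v (F i) = v (F j) -> i = j) ->
  forall i, v (F i) <= v (\sum_i F i).
Proof.
move=> Fd i0.
have [m _ mmax'] := @arg_maxP _ _ I i0 predT (fun i => v (F i)) isT.
have mmax i : v (F i) <= v (F m) by exact: mmax'.
suff -> : v (\sum_i F i) = v (F m) by exact: mmax.
have [Fm0|Fm0] := eqVneq (F m) 0.
  rewrite big1 ?Fm0// => i _; apply/eqP; rewrite -(absval_eq0 v) eq_le absval_ge0 andbT.
  by rewrite -(absval0 v) -Fm0; exact: mmax.
apply: ultra_eq; rewrite (bigD1 m)//= opprD addNKr absvalN.
apply: ultra_sum_lt => [|i im]; first by rewrite absval_gt0.
rewrite lt_neqAle mmax// andbT; apply: contraNneq im => vim.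
by rewrite (Fd m i).
Qed.

End Ultrametric.

(** * Balls and density *)

Section ValuedTopology.
Context (K : fieldType) (R : realType) (v : absval K R).

Lemma valued_ballE (x : valued v) (r : R) : ball x r = [set y : K | v (x - y) < r].
Proof. by rewrite ballEmdist. Qed.

Lemma dense_approx (S : set (valued v)) (x : K) (r : R) :
  dense S -> 0 < r -> exists2 y : K, S y & v (x - y) < r.
Proof.
move=> dS r0.
have xo : (ball (x : valued v) r)° (x : valued v) by apply: nbhsx_ballx.
have [|y [/interior_subset yb Sy]] := dS _ _ (@open_interior _ (ball (x : valued v) r)).
  by exists x.
by exists y => //; rewrite valued_ballE in yb.
Qed.

End ValuedTopology.

(** * The p-adic numbers: values, digits and floor *)

Section PadicField.
Context (p : nat) (p_prime : prime p) (Qp : fieldType) (R : realType).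
Context (vQ : absval Qp R) (QpP : is_padic_field p vQ).
Local Notation pR := (p%:R : R).

Let p_gt0 : (0 < p)%N := prime_gt0 p_prime.

Lemma pR_gt0 : 0 < pR.
Proof. by rewrite ltr0n. Qed.

Lemma pR_gt1 : 1 < pR.
Proof. by rewrite ltr1n prime_gt1. Qed.

Let pR0 := pR_gt0.
Let pR1 := pR_gt1.

Lemma padic_natE (n : nat) : (0 < n)%N -> vQ n%:R = pR ^- logn p n.
Proof. by case: QpP => h _ _; exact: h. Qed.

Lemma padic_p : vQ p%:R = pR^-1.
Proof. by rewrite padic_natE// -[X in logn p X]expn1 pfactorK// expr1. Qed.

Lemma padic_nat_le1 (n : nat) : vQ n%:R <= 1.
Proof.
case: n => [|n]; first by rewrite absval0.
by rewrite padic_natE// invf_le1 ?exprn_gt0// exprn_ege1// ltW.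
Qed.

Lemma padic_ultra : ultrametric vQ.
Proof. exact: absval_nat_ultrametric padic_nat_le1. Qed.
Let vQU := padic_ultra.

Lemma padic_nat_dvd (n k : nat) : (vQ n%:R <= pR ^- k) = (p ^ k %| n)%N.
Proof.
case: n => [|n]; first by rewrite absval0 dvdn0 invr_ge0 exprn_ge0// ltW.
by rewrite padic_natE// lef_pV2 ?posrE ?exprn_gt0// ler_eXn2l// pfactor_dvdn.
Qed.

Lemma padic_nat_inj (k m n : nat) : (m < p ^ k)%N -> (n < p ^ k)%N ->
  vQ (m%:R - n%:R) <= pR ^- k -> m = n.
Proof.
wlog mn : m n / (n <= m)%N => [hw mk nk|mk nk].
  have [/hw|/ltnW/hw h] := leqP n m; first exact.
  by rewrite absvalB => ?; apply/esym/h.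
rewrite -natrB// padic_nat_dvd => /dvdnP[[|q]]; last by rewrite mulSn; lia.
by lia.
Qed.

Lemma padic_int_abs (z : int) : vQ z%:~R = vQ (`|z|%N)%:R.
Proof.
case: z => n //; rewrite NegzE mulrNz absvalN.
by rewrite abszN.
Qed.

Lemma padic_p_neq0 : p%:R != 0 :> Qp.
Proof. by rewrite -(absval_gt0 vQ) padic_p invr_gt0. Qed.
Let p0 := padic_p_neq0.

Lemma padic_pz (z : int) : vQ (p%:R ^ z) = pR ^ (- z).
Proof. by rewrite absvalXz padic_p exprz_inv. Qed.

Lemma padic_rat_approx (x : Qp) (r : R) : 0 < r -> exists q : rat, vQ (x - ratr q) < r.
Proof.
case: QpP => _ _ dQ r0.
by have [_ [q _ <-] qx] := dense_approx x dQ r0; exists q.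
Qed.

(** A rational closer to [x] than [vQ x] has the same value as [x], so no values occur beyond those
    of the rationals. *)
Lemma padic_value (x : Qp) : x != 0 -> exists z : int, vQ x = pR ^ z.
Proof.
move=> x0; have vx0 : 0 < vQ x by rewrite absval_gt0.
have [q /(ultra_eq vQU) qx] := padic_rat_approx x vx0; rewrite -qx.
have : q != 0.
  by apply: contraTneq vx0 => q0; rewrite -qx q0 /ratr (_ : numq 0 = 0)// mul0r absval0 ltxx.
move=> q0; rewrite /ratr absvalM absvalV !padic_int_abs !padic_natE ?absz_gt0 ?numq_eq0 ?denq_eq0//.
exists ((logn p `|denq q|)%:Z - (logn p `|numq q|)%:Z).
by rewrite expfzDr ?gt_eqF// invrK mulrC exprnN.
Qed.

Lemma padic_lt1 (x : Qp) : vQ x < 1 -> vQ x <= pR^-1.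
Proof.
have [->|x0] := eqVneq x 0; first by rewrite absval0 invr_ge0 ltW.
have [z ->] := padic_value x0.
rewrite -[1](expr0z pR) ltr_eXz2l// => z0.
by rewrite -[pR^-1]exprN1 ler_eXz2l//; lia.
Qed.

(** A rational [q] close to [x] is integral, so [p] does not divide its denominator. Bezout gives an
    inverse [w] of the denominator modulo [p], and the digit is the numerator times [w], reduced
    modulo [p]. *)
Lemma padic_digit (x : Qp) : vQ x <= 1 -> exists2 a : nat, (a < p)%N & vQ (x - a%:R) < 1.
Proof.
move=> x1; have [q qx] := padic_rat_approx x ltr01.
have q1 : vQ (ratr q) <= 1.
  by rewrite -[ratr q](subKr x); apply: ultra_leB => //; exact: ltW.
have d0 : (0 < `|denq q|)%N by rewrite absz_gt0 denq_eq0.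
have pd : coprime p `|denq q|.
  rewrite prime_coprime//; apply/negP => pd.
  have vn : vQ (numq q)%:~R = 1.
    apply/eqP; rewrite eq_le padic_int_abs padic_nat_le1/= leNgt; apply/negP => vn.
    have /padic_lt1 := vn; rewrite -[pR^-1]/(pR ^- 1) padic_nat_dvd expn1 => pn.
    have := coprime_num_den q; rewrite /coprime => /eqP g1.
    have : (p %| gcdn `|numq q| `|denq q|)%N by rewrite dvdn_gcd pn.
    by rewrite g1 dvdn1; case: eqP p_prime => // ->.
  move: q1; rewrite /ratr absvalM vn mul1r absvalV padic_int_abs padic_natE// invrK.
  by apply/negP; rewrite -ltNge exprn_egt1// -lt0n logn_gt0 mem_primes p_prime d0.
have vd : vQ (denq q)%:~R = 1.
  rewrite padic_int_abs padic_natE// (_ : logn p _ = 0%N) ?expr0 ?invr1//.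
  by apply/eqP; rewrite logn_coprime.
have : coprimez p%:Z (denq q) by rewrite coprimezE.
move=> /coprimezP[[u w] /= uw].
pose n := numq q * w; pose a := `|(n %% p)%Z|%N.
have aE : a%:Z = (n %% p)%Z by rewrite gez0_abs// modz_ge0// eqz_nat gt_eqF.
have vmulp (z : Qp) : vQ z <= 1 -> vQ (z * p%:R) < 1.
  move=> z1; rewrite absvalM padic_p; apply: (@le_lt_trans _ _ (1 * pR^-1)).
    by rewrite ler_wpM2r// invr_ge0 ltW.
  by rewrite mul1r invf_lt1.
have vint_le1 (z : int) : vQ z%:~R <= 1 by rewrite padic_int_abs padic_nat_le1.
exists a; first by rewrite -ltz_nat aE ltz_pmod.
have -> : x - a%:R = x - ratr q + ((ratr q - n%:~R) + (n%:~R - a%:R)).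
  by rewrite addrA subrKA addrA subrK.
apply: ultra_lt => //; apply: ultra_lt => //.
- have -> : ratr q - n%:~R = (numq q)%:~R * u%:~R / (denq q)%:~R * p%:R :> Qp.
    have dq0 : (denq q)%:~R != 0 :> Qp by rewrite -(absval_gt0 vQ) vd.
    apply: (mulIf dq0); rewrite mulrBl /ratr divfK// mulrAC divfK//.
    rewrite -[p%:R]/(p%:Z%:~R) -!intrM -intrB; congr (_%:~R).
    by rewrite -[numq q in LHS]mulr1 -[1 in LHS]uw /n; ring.
  by apply: vmulp; rewrite absvalM absvalV vd invr1 mulr1 -intrM.
- rewrite -[a%:R]/(a%:Z%:~R) aE -intrB.
  have -> : n - (n %% p)%Z = (n %/ p)%Z * p by rewrite {1}(divz_eq n p) addrK.
  by rewrite intrM; apply: vmulp.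
Qed.

(** Scale [b] by a power of [p] until it is integral, then split off digits: [x = a + p * y] with
    [y] integral again. *)
Lemma padic_expansion (b : Qp) : exists (N : nat) (a : nat -> nat),
  (forall k, (a k < p)%N) /\
  forall n, vQ (b - digit_sum p Qp N a n) <= pR ^ (N%:Z - n%:Z).
Proof.
have [N bN] : exists N : nat, vQ (b * p%:R ^ N%:Z) <= 1.
  have [->|b0] := eqVneq b 0; first by exists 0%N; rewrite mul0r absval0.
  have [z bz] := padic_value b0; exists `|z|%N.
  rewrite absvalM bz padic_pz -expfzDr ?gt_eqF// -(expr0z pR) ler_eXz2l//; lia.
(* The remainder carries the proof of its integrality, so that [choice] yields a map that can be
   iterated. *)
have digP (x : {x : Qp | vQ x <= 1}) : exists y : nat * {x : Qp | vQ x <= 1},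
    (y.1 < p)%N /\ sval x - y.1%:R = sval y.2 * p%:R.
  case: x => x /= x1; have [c cp xc] := padic_digit x1.
  have y1 : vQ ((x - c%:R) / p%:R) <= 1.
    rewrite absvalM absvalV padic_p invrK -ler_pdivlMr// mul1r.
    exact: padic_lt1.
  by exists (c, exist (fun x => vQ x <= 1) _ y1) => /=; rewrite divfK.
have [g gP] := choice digP.
pose X n := iter n (fun x => (g x).2) (exist (fun x => vQ x <= 1) _ bN).
pose a n := (g (X n)).1.
have Xrec n : sval (X n) = (a n)%:R + sval (X n.+1) * p%:R.
  by rewrite -(gP (X n)).2 subrKC.
exists N, a; split=> [k|n]; first exact: (gP _).1.
have -> : b - digit_sum p Qp N a n = sval (X n) * p%:R ^ (n%:Z - N%:Z).
  rewrite /digit_sum; elim: n => [|n IH].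
    by rewrite big_geq// subr0 sub0r /= -mulrA -expfzDr// subrr mulr1.
  rewrite big_nat_recr//= opprD addrA IH Xrec mulrDl addrAC subrr add0r.
  by rewrite -mulrA (_ : n.+1%:Z - N%:Z = 1 + (n%:Z - N%:Z)) ?expfzDr ?expr1z//; lia.
rewrite absvalM padic_pz opprB -[leRHS]mul1r ler_wpM2r ?exprz_ge0 ?(ltW pR0)//.
exact: (svalP (X n)).
Qed.

Lemma digit_sum_int (N : nat) (a : nat -> nat) (n : nat) : (forall k, (a k < p)%N) ->
  exists2 M : nat, (M < p ^ n)%N & digit_sum p Qp N a n = M%:R * p%:R ^ (- N%:Z).
Proof.
move=> ap; exists (\sum_(0 <= k < n) a k * p ^ k)%N.
  elim: n => [|n IH]; first by rewrite big_geq// expn0.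
  rewrite big_nat_recr//= expnS.
  have := ap n; rewrite -ltnS -(leq_pmul2r (_ : 0 < p ^ n)%N) ?expn_gt0 ?p_gt0//.
  by lia.
rewrite /digit_sum natr_sum mulr_suml; apply: eq_bigr => k _.
by rewrite natrM natrX expfzDr// mulrA.
Qed.

(** [xget] may select any expansion of [b], so only properties common to all expansions are
    extracted. *)
Lemma padic_floorP (b : Qp) : exists N M : nat,
  [/\ (M < p ^ N.+1)%N, padic_floor p vQ b = M%:R * p%:R ^ (- N%:Z) &
      vQ (b - padic_floor p vQ b) < 1].
Proof.
rewrite /padic_floor; case: xgetP => [c _ [N [a [ap acvg ->]]]|].
  have [M Mp ME] := digit_sum_int N N.+1 ap; exists N, M; split => //.
  have := acvg => /cvgrPdist_lt/(_ _ ltr01)[m _ /(_ (maxn m N.+1))] /=.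
  rewrite leq_maxl sub0r normrN ger0_norm ?absval_ge0// => /(_ isT).
  (* The truncation at [q] is within 1 of [b], and its terms of index at least [N.+1] all have value
     below 1. *)
  set q := maxn _ _ => bq.
  rewrite -(subrKA (digit_sum p Qp N a q)); apply: ultra_lt => //.
  have Nq : (N.+1 <= q)%N by rewrite leq_maxr.
  rewrite /digit_sum (big_cat_nat _ Nq)//= addrAC subrr add0r big_nat.
  apply: ultra_sum_lt => // k /andP[Nk _].
  rewrite absvalM padic_pz; apply: (@le_lt_trans _ _ (1 * pR ^ (- (k%:Z - N%:Z)))).
    by rewrite ler_wpM2r ?padic_nat_le1// exprz_ge0// ltW.
  by rewrite mul1r -(expr0z pR) ltr_eXz2l//; lia.
(* The default value of [xget] does not occur, since an expansion exists. *)
move=> none; exfalso; have [N [a [ap aP]]] := padic_expansion b.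
apply: (none (digit_sum p Qp N a N.+1)); exists N, a; split => //.
apply/cvgrPdist_le => eps eps0.
have : pR ^ N * pR^-1 ^+ n @[n --> \oo] --> 0.
  rewrite -[0](mulr0 (pR ^ N)); apply: cvgM; first exact: cvg_cst.
  by apply: cvg_expr; rewrite ger0_norm ?invf_lt1// invr_ge0 ltW.
move=> /cvgrPdist_le/(_ _ eps0); apply: filterS => n.
rewrite !sub0r !normrN !ger0_norm ?absval_ge0//.
apply: le_trans; apply: le_trans (aP n) _.
by rewrite expfzDr ?gt_eqF// exprVn exprnN.
Qed.

(** Over the common denominator [p ^ (N' + N)] the numerators are naturals below [p ^ (N' + N).+1].
    A difference of value below 1 has value at most [p^-1], which makes them congruent modulo that
    bound. *)
Lemma padic_floor_uniq (b c : Qp) :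
  vQ (padic_floor p vQ b - padic_floor p vQ c) < 1 ->
  padic_floor p vQ b = padic_floor p vQ c.
Proof.
have [N [M [Mp -> _]]] := padic_floorP b.
have [N' [M' [Mp' -> _]]] := padic_floorP c.
have pX (n n' : nat) : p%:R ^ (- n%:Z) = (p ^ n')%:R * p%:R ^ (- (n + n')%:Z) :> Qp.
  by rewrite natrX [p%:R ^+ _]exprnP -expfzDr//; congr (_ ^ _); lia.
rewrite (pX N N') (pX N' N) addnC !mulrA -!natrM -mulrBl.
set m := (M * _)%N; set m' := (M' * _)%N.
have mlt : (m < p ^ (N' + N).+1)%N.
  by rewrite /m -addSn addnC -addSnnS expnD ltn_pmul2r ?expn_gt0 ?p_gt0// addSnnS.
have mlt' : (m' < p ^ (N' + N).+1)%N.
  by rewrite /m' -addSn expnD ltn_pmul2r ?expn_gt0 ?p_gt0.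
move=> /padic_lt1; rewrite absvalM padic_pz opprK -ler_pdivlMr ?exprz_gt0// => H.
by rewrite (@padic_nat_inj (N' + N).+1 m m')// exprSr invfM mulrC.
Qed.

Lemma padic_floor_rat (b : Qp) :
  exists z : nat * nat, padic_floor p vQ b = z.2%:R * p%:R ^ (- z.1%:Z).
Proof. by have [N [M [_ h _]]] := padic_floorP b; exists (N, M). Qed.

End PadicField.

(** * Limits in the p-adic numbers *)

Section Completeness.
Context (p : nat) (p_prime : prime p) (Qp : fieldType) (R : realType).
Context (vQ : absval Qp R) (QpP : is_padic_field p vQ).

(** The rate survives in the limit because passing through a late term [u m] costs no constant in
    the ultrametric inequality. *)
Lemma padic_limit (u : nat -> Qp) (r : nat -> R) : r n @[n --> \oo] --> 0 ->
  (forall n m, (n <= m)%N -> vQ (u m - u n) <= r n) ->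
  exists l, forall n, vQ (l - u n) <= r n.
Proof.
move=> r0 ur; have vQU := padic_ultra p_prime QpP.
pose U : nat -> valued vQ := u.
have cU : cauchy (U n @[n --> \oo]).
  apply: cauchy_exP => eps eps0.
  have [N _ /(_ N (leqnn N)) rN] : \forall n \near \oo, r n < eps by exact: (cvgr_lt _ r0).
  exists (U N); exists N => // m /= Nm; rewrite valued_ballE/= absvalB.
  exact: le_lt_trans (ur _ _ Nm) rN.
case: QpP => _ /(_ (U n @[n --> \oo]) _ cU) cv _.
set l := lim (U n @[n --> \oo]) in cv.
exists l => n; rewrite leNgt; apply/negP => rl.
have e0 : 0 < vQ (l - u n).
  exact: le_lt_trans (le_trans (absval_ge0 _ _) (ur n n (leqnn n))) rl.
have [N _ NP] := cv _ (nbhsx_ballx l _ e0).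
have := NP (maxn n N) (leq_maxr _ _); rewrite valued_ballE/= => h.
have : vQ (l - u n) < vQ (l - u n).
  rewrite -{1}(subrKA (u (maxn n N))); apply: ultra_lt => //.
  by apply: le_lt_trans rl; apply: ur; rewrite leq_maxl.
by rewrite ltxx.
Qed.

End Completeness.

(** * Residue classes and value classes of K *)

Section LocalFieldBasis.
Context (p : nat) (p_prime : prime p) (Qp : fieldType) (R : realType).
Context (vQ : absval Qp R) (QpP : is_padic_field p vQ).
Context (K : fieldExtType Qp) (v : absval K R).
Context (v_ext : forall x : Qp, v x%:A = vQ x).
Context (e f : nat) (eP : ramification_index vQ v {:K}%AS e).
Context (fP : residue_degree vQ v f) (gamma beta : K).
Context (gamma_root : (p ^ f - 1)%N.-primitive_root gamma).
Context (beta_abs : v beta = p%:R `^ (e%:R^-1)).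
Local Notation pR := (p%:R : R).

Let p_gt0 : (0 < p)%N := prime_gt0 p_prime.
Let pR0 := pR_gt0 p_prime R.
Let pR1 := pR_gt1 p_prime R.
Let vQU := padic_ultra p_prime QpP.

Lemma absval_ext_nat (n : nat) : v n%:R = vQ n%:R.
Proof. by rewrite -v_ext scaler_nat. Qed.

Lemma absval_ext_ultra : ultrametric v.
Proof.
by apply: absval_nat_ultrametric => n; rewrite absval_ext_nat; exact: (padic_nat_le1 p_prime QpP).
Qed.
Let vU := absval_ext_ultra.

Lemma absvalZ (c : Qp) (x : K) : v (c *: x) = vQ c * v x.
Proof. by rewrite -mulr_algl absvalM v_ext. Qed.

Lemma ramification_index_gt0 : (0 < e)%N.
Proof.
have [t [_ tP]] := eP; have [i _] := tP 1 (memvf _) (oner_neq0 _).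
by case: i => i; exact: leq_trans.
Qed.
Let e_gt0 := ramification_index_gt0.

Lemma residue_degree_gt0 : (0 < f)%N.
Proof.
have [t [_ tP _]] := fP; rewrite lt0n; apply/eqP => f0.
have [|c [_]] := tP 1; first by rewrite absval1.
by rewrite big1 ?subr0 ?absval1 ?ltxx// => i; have := ltn_ord i; rewrite {2}f0.
Qed.
Let f_gt0 := residue_degree_gt0.

Lemma absval_root1 (z : K) (n : nat) : (0 < n)%N -> z ^+ n = 1 -> v z = 1.
Proof.
move=> n0 zn; have : v z ^+ n == 1 by rewrite -absvalX zn absval1.
by rewrite pexpr_eq1 ?absval_ge0 -?lt0n// => /eqP.
Qed.

Lemma absval_gamma : v gamma = 1.
Proof.
by apply: absval_root1 (prim_expr_order gamma_root); exact: prim_order_gt0 gamma_root.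
Qed.

Lemma absval_beta_exp : v beta ^+ e = pR.
Proof.
rewrite beta_abs -powR_mulrn ?powR_ge0// -powRrM mulVf ?powRr1 ?ltW//.
by rewrite pnatr_eq0 -lt0n.
Qed.
Let w := v beta.

Lemma absval_beta_gt1 : 1 < w.
Proof.
rewrite ltNge; apply/negP => w1.
have : pR <= 1 by rewrite -absval_beta_exp exprn_ile1 ?absval_ge0.
by rewrite leNgt pR1.
Qed.
Let w1 := absval_beta_gt1.
Let w0 : 0 < w := lt_trans ltr01 w1.

(* If [z] is congruent to 1, then [0 = 1 + z + ... + z^(n-1)] is congruent to
   [n], which is a unit. *)
Lemma root_unity_residue (z : K) (n : nat) : coprime p n -> z ^+ n = 1 -> z != 1 ->
  v (z - 1) = 1.
Proof.
move=> pn zn z1; have n0 : (0 < n)%N.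
  by case: n pn {zn} => //; rewrite /coprime gcdn0; case: eqP p_prime => // ->.
have vz := absval_root1 n0 zn.
have le1 : v (z - 1) <= 1 by apply: ultra_leB => //; rewrite ?vz ?absval1.
apply/eqP; rewrite eq_le le1 leNgt; apply/negP => lt1.
have zk k : v (z ^+ k - 1) < 1.
  elim: k => [|k IH]; first by rewrite expr0 subrr absval0.
  have -> : z ^+ k.+1 - 1 = z * (z ^+ k - 1) + (z - 1) by rewrite exprS; ring.
  apply: ultra_lt => //.
  by rewrite absvalM vz mul1r.
have s0 : \sum_(i < n) z ^+ i = 0.
  by apply: (@mulfI _ (z - 1)); rewrite ?subr_eq0// mulr0 -subrX1 zn subrr.
have : v (\sum_(i < n) (z ^+ i - 1)) < 1 by apply: ultra_sum_lt => // i _; exact: zk.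
rewrite sumrB s0 sub0r absvalN sumr_const card_ord absval_ext_nat (padic_natE QpP)//.
by rewrite (_ : logn p n = 0%N) ?expr0 ?invr1 ?ltxx//; apply/eqP; rewrite logn_coprime.
Qed.

Lemma gamma_residue (i j : 'I_(p ^ f - 1)) : i != j -> v (gamma ^+ i - gamma ^+ j) = 1.
Proof.
wlog ij : i j / (j <= i)%N.
  move=> h ij; have [/h|/ltnW/h] := leqP j i; first exact.
  by rewrite absvalB eq_sym; exact.
move=> neq; have -> : gamma ^+ i - gamma ^+ j = gamma ^+ j * (gamma ^+ (i - j) - 1).
  by rewrite mulrBr mulr1 -exprD subnKC.
rewrite absvalM absvalX absval_gamma expr1n mul1r.
apply: (@root_unity_residue _ (p ^ f - 1)%N).
- rewrite prime_coprime//; apply/negP => pd.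
  have : (p %| 1)%N.
    rewrite -(subKn (_ : 1 <= p ^ f)%N) ?expn_gt0 ?p_gt0//.
    by rewrite dvdn_sub// dvdn_exp.
  by rewrite dvdn1; case: eqP p_prime => // ->.
- by rewrite -exprM mulnC exprM (prim_expr_order gamma_root) expr1n.
- rewrite -(prim_order_dvd gamma_root) gtnNdvd//; last by have := ltn_ord i; lia.
  by rewrite subn_gt0 ltn_neqAle ij andbT eq_sym.
Qed.

(** The span, over the residue field of [Qp], of the classes of the first [d] powers of [gamma],
    phrased by representatives so that no quotient is formed. *)
Definition integral_span (d : nat) (x : K) := exists b : nat -> Qp,
  (forall j, vQ (b j) <= 1) /\ v (x - \sum_(j < d) b j *: gamma ^+ j) < 1.

Lemma integral_span0 d : integral_span d 0.
Proof.
exists (fun=> 0); split=> [j|]; first by rewrite absval0.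
by rewrite big1 ?subr0 ?absval0// => j _; rewrite scale0r.
Qed.

Lemma integral_spanD d (x y : K) (c : Qp) : vQ c <= 1 ->
  integral_span d x -> integral_span d y -> integral_span d (x + c *: y).
Proof.
move=> c1 [b [b1 xb]] [b' [b1' yb]].
exists (fun j => b j + c * b' j); split=> [j|].
  by apply: ultra_le => //; rewrite absvalM mulr_ile1 ?absval_ge0.
under eq_bigr do rewrite scalerDl -scalerA.
rewrite big_split/= -scaler_sumr opprD addrACA -scalerBr.
apply: ultra_lt => //; rewrite absvalZ; apply: le_lt_trans yb.
by rewrite ler_piMl ?absval_ge0.
Qed.

Lemma integral_span_congr d (x y : K) : v (x - y) < 1 ->
  integral_span d x -> integral_span d y.
Proof.
move=> xy [b [b1 xb]]; exists b; split => //.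
by rewrite -(subrKA x); apply: ultra_lt => //; rewrite absvalB.
Qed.

Lemma integral_span_lt d (i : nat) : (i < d)%N -> integral_span d (gamma ^+ i).
Proof.
move=> id; exists (fun j => (j == i)%:R); split=> [j|].
  exact: (padic_nat_le1 p_prime QpP).
rewrite (bigD1 (Ordinal id))//= eqxx scale1r big1 ?addr0 ?subrr ?absval0// => j.
by rewrite -val_eqE/= => /negPf ->; rewrite scale0r.
Qed.

(** Codes a class by one of [p ^ d] functions, for the counting arguments. *)
Lemma integral_span_digits d (t : 'I_d -> K) (b : 'I_d -> Qp) (x : K) :
  (forall j, v (t j) <= 1) -> (forall j, vQ (b j) <= 1) ->
  v (x - \sum_(j < d) b j *: t j) < 1 ->
  exists g : {ffun 'I_d -> 'I_p}, v (x - \sum_(j < d) (g j)%:R *: t j) < 1.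
Proof.
move=> t1 b1 xb; have digP j : exists a : 'I_p, vQ (b j - a%:R) < 1.
  by have [a ap ba] := padic_digit p_prime QpP (b1 j); exists (Ordinal ap).
have [g gP] := choice digP; exists (finfun g).
rewrite -(subrKA (\sum_(j < d) b j *: t j)); apply: ultra_lt => //.
rewrite -sumrB; apply: ultra_sum_lt => // j _.
rewrite -scalerBl absvalZ ffunE; apply: le_lt_trans (gP j).
by rewrite ler_piMr ?absval_ge0.
Qed.

Let gammaX1 i : v (gamma ^+ i) <= 1.
Proof. by rewrite absvalX absval_gamma expr1n. Qed.

(* A relation modulo the maximal ideal expressing [gamma^d], [d < f], through
   lower powers would leave at most [p^d] residue classes for the [p^f]
   pairwise incongruent elements 0, 1, gamma, gamma^2, ... *)
Lemma gamma_indep d (b : nat -> Qp) : (d <= f)%N -> (forall j, vQ (b j) <= 1) ->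
  v (\sum_(j < d) b j *: gamma ^+ j) < 1 -> forall j, (j < d)%N -> vQ (b j) < 1.
Proof.
elim: d => // d IH df b1; rewrite big_ord_recr/= => s1.
have [bd|bd] := ltP (vQ (b d)) 1.
  move=> j; rewrite ltnS leq_eqVlt => /predU1P[->//|]; apply: IH => //; first exact: ltnW.
  rewrite -[X in v X](addrK (b d *: gamma ^+ d)); apply: ultra_ltB => //.
  by rewrite absvalZ; apply: le_lt_trans bd; rewrite ler_piMr ?absval_ge0.
have {}bd : vQ (b d) = 1 by apply/eqP; rewrite eq_le bd b1.
have bd0 : b d != 0 by rewrite -(absval_eq0 vQ) bd oner_neq0.
exfalso.
(* The relation solved for [gamma ^+ d] and multiplied by [gamma ^+ n]; it reduces every power of
   [gamma] to the first [d]. *)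
have rel n : v (gamma ^+ (n + d) - \sum_(j < d) - (b j / b d) *: gamma ^+ (n + j)) < 1.
  have -> : gamma ^+ (n + d) - \sum_(j < d) - (b j / b d) *: gamma ^+ (n + j) =
     gamma ^+ n * ((b d)^-1 *: (\sum_(j < d) b j *: gamma ^+ j + b d *: gamma ^+ d)).
    rewrite scalerDr scalerA mulVf// scale1r mulrDr -exprD addrC; congr (_ + _).
    rewrite -sumrN scaler_sumr mulr_sumr; apply: eq_bigr => j _.
    by rewrite scaleNr opprK exprD scalerA -scalerAr [b j / _]mulrC.
  by rewrite absvalM absvalX absval_gamma expr1n mul1r absvalZ absvalV bd invr1 mul1r.
have spanX n : integral_span d (gamma ^+ n).
  elim/ltn_ind: n => n IHn; have [/integral_span_lt//|dn] := ltnP n d.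
  have := rel (n - d)%N; rewrite subnK// absvalB => /integral_span_congr; apply.
  elim/big_ind : _ => [|x y sx sy|j _]; first exact: integral_span0.
    by rewrite -[y]scale1r; apply: integral_spanD => //; rewrite absval1.
  rewrite -[X in integral_span _ X]add0r; apply: integral_spanD.
  - by rewrite absvalN absvalM absvalV bd invr1 mulr1.
  - exact: integral_span0.
  - by apply: IHn; have := ltn_ord j; lia.
pose X (o : option 'I_(p ^ f - 1)) : K := if o is Some i then gamma ^+ i else 0.
have Xneq o o' : o != o' -> v (X o - X o') = 1.
  case: o o' => [i|] [j|]//= ij; first exact: gamma_residue.
  - by rewrite subr0 absvalX absval_gamma expr1n.
  - by rewrite sub0r absvalN absvalX absval_gamma expr1n.
have digP o : exists g : {ffun 'I_d -> 'I_p},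
    v (X o - \sum_(j < d) (g j)%:R *: gamma ^+ j) < 1.
  have [c [c1 xc]] : integral_span d (X o).
    by case: o => [i|]; [exact: spanX|exact: integral_span0].
  by apply: (@integral_span_digits d (fun j => gamma ^+ j) (fun j => c j)).
have [g gP] := choice digP.
have ginj : injective g.
  move=> o o' goo'; apply/eqP/negPn/negP => oo'.
  have : v (X o - X o') < 1.
    rewrite -(subrKA (\sum_(j < d) (g o j)%:R *: gamma ^+ j)); apply: ultra_lt => //.
    by rewrite absvalB goo'.
  by rewrite (Xneq _ _ oo') ltxx.
have := leq_card g ginj; rewrite card_option card_ffun !card_ord subn1 prednK ?expn_gt0 ?p_gt0//.
by rewrite leq_exp2l ?prime_gt1// leqNgt df.
Qed.

(** Counting replaces linear algebra: [H] turns the digits of a class on the powers of [gamma] into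
    digits on the given basis [t]. It is injective by [gamma_indep], hence onto, as a map of a
    finite type to itself. *)
Lemma integral_span_residue (x : K) : v x <= 1 ->
  exists b : 'I_f -> Qp, (forall j, vQ (b j) <= 1) /\ v (x - \sum_j b j *: gamma ^+ j) < 1.
Proof.
have [t [t1 tP _]] := fP; have digP (y : {y | v y <= 1}) : exists g : {ffun 'I_f -> 'I_p},
    v (sval y - \sum_(j < f) (g j)%:R *: t j) < 1.
  by case: y => y /= /tP[c [c1 yc]]; exact: integral_span_digits yc.
have [G GP] := choice digP.
have S1 (h : {ffun 'I_f -> 'I_p}) : v (\sum_(j < f) (h j)%:R *: gamma ^+ j) <= 1.
  apply: ultra_sum_le => // j _; rewrite absvalZ absvalX absval_gamma expr1n mulr1.
  exact: (padic_nat_le1 p_prime QpP).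
pose H h := G (exist (fun y => v y <= 1) _ (S1 h)).
have Hinj : injective H.
  move=> h h' Hhh'; apply/ffunP => j.
  have := GP (exist (fun y => v y <= 1) _ (S1 h)).
  have := GP (exist (fun y => v y <= 1) _ (S1 h')).
  rewrite -/(H h) -/(H h') -Hhh' /= => q' q; have := ultra_ltB vU q q'.
  rewrite opprB subrKA -sumrB => s1.
  have : vQ ((h j)%:R - (h' j)%:R) < 1.
    (* [gamma_indep] has coefficients indexed by [nat], for its induction on [d]; they are padded
       with 0. *)
    pose b k := if insub k is Some i then (h i)%:R - (h' i)%:R : Qp else 0.
    have bE (k : 'I_f) : b k = (h k)%:R - (h' k)%:R by rewrite /b valK.
    rewrite -bE; apply: (@gamma_indep f b) => // [k|].
      rewrite /b; case: insubP => [i _ _|_]; last by rewrite absval0.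
      by apply: ultra_leB => //; exact: (padic_nat_le1 p_prime QpP).
    apply: le_lt_trans s1; rewrite le_eqVlt; apply/orP; left; apply/eqP; congr (v _).
    by apply: eq_bigr => i _; rewrite bE scalerBl.
  move=> /(padic_lt1 p_prime QpP); rewrite -[p%:R^-1]/(p%:R ^- 1) => lt1.
  by apply/val_inj/(padic_nat_inj p_prime QpP _ _ lt1); rewrite expn1.
move=> x1; have [h hE] : exists h, H h = G (exist (fun y => v y <= 1) _ x1).
  by have [H' _ HK] := injF_bij Hinj; exists (H' (G (exist (fun y => v y <= 1) _ x1))).
exists (fun j => (h j)%:R); split=> [j|]; first exact: (padic_nat_le1 p_prime QpP).
have /= q := GP (exist (fun y => v y <= 1) _ x1).
have /= := GP (exist (fun y => v y <= 1) _ (S1 h)); rewrite -/(H h) hE => q'.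
by have := ultra_ltB vU q q'; rewrite opprB subrKA.
Qed.

(** As [vQ c] is a power of [p = w ^+ e], both sides are powers of [w] whose exponents are congruent
    to [i] and [j] modulo [e]. *)
Lemma absval_beta_class (i j : nat) (c c' : Qp) : (i < e)%N -> (j < e)%N -> c != 0 ->
  vQ c * w ^+ i = vQ c' * w ^+ j -> i = j.
Proof.
move=> ie je c0 E; have c'0 : c' != 0.
  rewrite -(absval_gt0 vQ) -(pmulr_lgt0 _ (exprn_gt0 j w0)) -E.
  by rewrite mulr_gt0 ?absval_gt0// exprn_gt0.
have [z zE] := padic_value p_prime QpP c0; have [z' zE'] := padic_value p_prime QpP c'0.
move: E; rewrite zE zE' -absval_beta_exp !exprnP -/w !exprz_exp.
rewrite -!expfzDr ?gt_eqF//.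
move=> /(ieexprIz w0 (negbT (gt_eqF w1))) E.
have : (z - z') * e%:Z = j%:Z - i%:Z by move: E; lia.
have [->|] := eqVneq z z'; first by lia.
by move=> ? ?; nia.
Qed.

(** The powers [beta ^+ i], [i < e], lie in distinct value classes, and [eP] provides exactly [e]
    classes; so [g] is a bijection. *)
Lemma absval_beta_rep (x : K) : x != 0 ->
  exists (i : 'I_e) (c : Qp), c != 0 /\ v x = vQ c * w ^+ i.
Proof.
have [t [tK tP]] := eP; have idx (i : 'I_e) : exists k, exists c, v (beta ^+ i) = vQ c * v (t k).
  have [|k [kP _]] := tP (beta ^+ i) (memvf _); last by exists k.
  by rewrite expf_neq0// -(absval_gt0 v).
have [g gP] := choice idx.
have ginj : injective g.
  move=> i j gij; have [c] := gP i; have [c'] := gP j; rewrite gij !absvalX -/w => E' E.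
  have t0 : 0 < v (t (g j)) by rewrite absval_gt0; exact: (tK _).2.
  have cpos k d : w ^+ k = vQ d * v (t (g j)) -> d != 0.
    by move=> h; rewrite -(absval_gt0 vQ) -(pmulr_lgt0 _ t0) -h exprn_gt0.
  apply: val_inj; apply: (@absval_beta_class i j c' c) => //; first exact: cpos E'.
  by rewrite E E' mulrCA.
move=> x0; have [k [[c xc] _]] := tP x (memvf _) x0.
have [g' _ gK] := injF_bij ginj; have [c'] := gP (g' k); rewrite gK absvalX -/w => E.
have vx0 : 0 < v x by rewrite absval_gt0.
have c'0 : c' != 0.
  apply/eqP => c'0; have := exprn_gt0 (g' k) w0; by rewrite E c'0 absval0 mul0r ltxx.
exists (g' k), (c / c'); have E2 : v x = vQ (c / c') * w ^+ g' k.
  by rewrite E absvalM absvalV mulrA divfK// absval_eq0.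
split => //; apply/eqP => q; move: vx0; by rewrite E2 q absval0 mul0r ltxx.
Qed.

(** [beta^-1] is a uniformizer: every nonzero value is an integral power of [w]. *)
Lemma absval_discrete (x : K) : v x < 1 -> v x <= w^-1.
Proof.
have [->|x0] := eqVneq x 0; first by rewrite absval0 invr_ge0 ltW.
have [i [c [c0 ->]]] := absval_beta_rep x0; have [z ->] := padic_value p_prime QpP c0.
rewrite -absval_beta_exp -/w exprnP exprz_exp exprnP -expfzDr ?gt_eqF//.
by rewrite -{1}(expr0z w) ltr_eXz2l// -[w^-1]exprN1 ler_eXz2l//; lia.
Qed.

(** * Coordinates in the basis gamma^j beta^i *)

Let gb (b : 'M[Qp]_(e, f)) := gb_sum gamma beta b.

Lemma gb_sumE b : gb b = \sum_(i < e) (\sum_(j < f) b i j *: gamma ^+ j) * beta ^+ i.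
Proof.
apply: eq_bigr => i _; rewrite mulr_suml; apply: eq_bigr => j _.
by rewrite scalerAl.
Qed.

Lemma gb_sumB b c : gb (b - c) = gb b - gb c.
Proof.
rewrite /gb /gb_sum -sumrB; apply: eq_bigr => i _; rewrite -sumrB.
by apply: eq_bigr => j _; rewrite !mxE scalerBl.
Qed.

Lemma gb_sum0 : gb 0 = 0.
Proof. by rewrite -(subrr 0) gb_sumB subrr. Qed.

Lemma gb_sumD b c : gb (b + c) = gb b + gb c.
Proof. by rewrite -[c in LHS]opprK -[- c]sub0r !gb_sumB gb_sum0 sub0r opprK. Qed.

(** After division by a coefficient of maximal value, [gamma_indep] rules out cancellation below
    that value. *)
Lemma absval_gamma_sum (b : 'I_f -> Qp) :
  exists k, v (\sum_j b j *: gamma ^+ j) = vQ (b k) /\ forall j, vQ (b j) <= vQ (b k).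
Proof.
have [k _ kmax'] := @arg_maxP _ _ _ (Ordinal f_gt0) predT (fun i => vQ (b i)) isT.
have kmax i : vQ (b i) <= vQ (b k) by exact: kmax'.
exists k; split => //.
have [bk|bk] := eqVneq (b k) 0.
  rewrite bk absval0 big1 ?absval0// => j _.
  have := kmax j; rewrite bk absval0 => bj.
  have -> : b j = 0 by apply/eqP; rewrite -(absval_eq0 vQ) eq_le bj absval_ge0.
  by rewrite scale0r.
have vbk : 0 < vQ (b k) by rewrite absval_gt0.
apply/eqP; rewrite eq_le; apply/andP; split.
  apply: ultra_sum_le => //; first exact: ltW.
  by move=> j _; rewrite absvalZ absvalX absval_gamma expr1n mulr1.
rewrite leNgt; apply/negP => lt.
pose c n := if insub n is Some i then b i / b k else 0 : Qp.
have cE (j : 'I_f) : c j = b j / b k by rewrite /c valK.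
have c1 j : vQ (c j) <= 1.
  rewrite /c; case: insubP => [i _ _|_]; last by rewrite absval0.
  by rewrite absvalM absvalV ler_pdivrMr// mul1r.
have := gamma_indep (leqnn f) c1.
have -> : \sum_(j < f) c j *: gamma ^+ j = (b k)^-1 *: \sum_j b j *: gamma ^+ j.
  rewrite scaler_sumr; apply: eq_bigr => j _.
  by rewrite cE scalerA mulrC.
rewrite absvalZ absvalV mulrC ltr_pdivrMr// mul1r => /(_ lt k (ltn_ord k)).
by rewrite cE divff// absval1 ltxx.
Qed.

(** The inner sums have values in the value group of [Qp], so the nonzero terms [s i * beta ^+ i]
    have pairwise distinct values and the largest one dominates. *)
Lemma gb_sum_ge (b : 'M[Qp]_(e, f)) i j : vQ (b i j) * w ^+ i <= v (gb b).
Proof.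
rewrite gb_sumE; set s := fun i => \sum_(j < f) b i j *: gamma ^+ j.
have sv k : exists2 c, v (s k) = vQ c & forall j, vQ (b k j) <= vQ c.
  by have [l [sl lmax]] := absval_gamma_sum (b k); exists (b k l).
apply: (@le_trans _ _ (v (s i * beta ^+ i))).
  have [c sc cmax] := sv i.
  by rewrite absvalM absvalX sc ler_wpM2r// exprn_ge0// ltW.
apply: (ultra_sum_distinct vU (F := fun i => s i * beta ^+ i)) => k l sk0.
rewrite !absvalM !absvalX; have [c sc _] := sv k; have [c' sc' _] := sv l.
rewrite sc sc' => E; apply: val_inj; apply: absval_beta_class E => //.
by rewrite -(absval_eq0 vQ) -sc absval_eq0; apply: contraNneq sk0 => ->; rewrite mul0r.
Qed.

Lemma gb_sum_entry (b : 'M[Qp]_(e, f)) i j : vQ (b i j) <= v (gb b).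
Proof.
by apply: le_trans (gb_sum_ge b i j); rewrite ler_peMr ?absval_ge0// exprn_ege1// ltW.
Qed.

Lemma absval_term b (i : 'I_e) (j : 'I_f) :
  v (b *: (gamma ^+ j * beta ^+ i)) = vQ b * w ^+ i.
Proof. by rewrite absvalZ absvalM !absvalX absval_gamma expr1n mul1r. Qed.

(** Crude, as [w ^+ i <= w ^+ e = p], but enough for the limit in [gb_sum_surj]. *)
Lemma gb_sum_le (b : 'M[Qp]_(e, f)) (r : R) : 0 <= r ->
  (forall i j, vQ (b i j) <= r) -> v (gb b) <= pR * r.
Proof.
move=> r0 br; have pr0 : 0 <= pR * r by rewrite mulr_ge0// ltW.
apply: ultra_sum_le => // i _; apply: ultra_sum_le => // j _.
rewrite absval_term mulrC ler_pM ?absval_ge0 ?exprn_ge0 ?(ltW w0)//.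
by rewrite -absval_beta_exp ler_eXn2l// ltnW.
Qed.

(** The gap between [p^-1] and 1 in the values of [vQ] absorbs the weights [w ^+ i < p]. *)
Lemma gb_sum_lt1 (b : 'M[Qp]_(e, f)) : v (gb b) < 1 <-> forall i j, vQ (b i j) < 1.
Proof.
split=> [b1 i j|b1]; first exact: le_lt_trans (gb_sum_entry _ _ _) b1.
apply: ultra_sum_lt => // i _; apply: ultra_sum_lt => // j _.
rewrite absval_term; apply: (@le_lt_trans _ _ (pR^-1 * w ^+ i)).
  by rewrite ler_wpM2r ?exprn_ge0 ?(ltW w0)//; exact: padic_lt1 (b1 i j).
by rewrite mulrC ltr_pdivrMr// mul1r -absval_beta_exp ltr_eXn2l.
Qed.

Lemma gb_sum_inj : injective gb.
Proof.
move=> b c bc; apply/matrixP => i j; apply/eqP; rewrite -subr_eq0 -(absval_eq0 vQ).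
have := gb_sum_entry (b - c) i j; rewrite gb_sumB bc subrr absval0 !mxE => h.
by rewrite eq_le h absval_ge0.
Qed.

(** Divide [x] by some [c *: beta ^+ i] of the same value and expand the residue class of the
    quotient. The error has value below 1, hence at most [w^-1] by discreteness. *)
Lemma gb_sum_approx (x : K) : exists M : 'M[Qp]_(e, f),
  (forall i j, vQ (M i j) <= v x) /\ v (x - gb M) <= w^-1 * v x.
Proof.
have [->|x0] := eqVneq x 0.
  exists 0; rewrite gb_sum0.
  by rewrite subrr absval0 mulr0; split => // i j; rewrite mxE absval0.
have [i [c [c0 xE]]] := absval_beta_rep x0.
have cb0 : c *: beta ^+ i != 0.
  by rewrite -(absval_gt0 v) absvalZ absvalX mulr_gt0 ?absval_gt0 ?exprn_gt0.
have vcb : v (c *: beta ^+ i) = v x by rewrite absvalZ absvalX xE.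
have vx0 : 0 < v x by rewrite absval_gt0.
pose u := x / (c *: beta ^+ i).
have vu : v u = 1 by rewrite absvalM absvalV vcb divff// gt_eqF.
have [|b [b1 ub]] := @integral_span_residue u; first by rewrite vu.
exists (\matrix_(k, j) if k == i then c * b j else 0); split=> [k j|].
  rewrite mxE; case: eqP => _; last by rewrite absval0 ltW.
  rewrite absvalM xE ler_pM ?absval_ge0//.
  by apply: le_trans (b1 j) _; rewrite exprn_ege1// ltW.
set M := \matrix_(k, j) _.
have gbM : gb M = (\sum_j b j *: gamma ^+ j) * (c *: beta ^+ i).
  rewrite gb_sumE (bigD1 i)//= [X in _ * _ + X]big1 ?addr0 => [|k /negPf ki].
    rewrite -scalerAr scalerAl; congr (_ * _); rewrite scaler_sumr.
    by apply: eq_bigr => j _; rewrite mxE eqxx scalerA.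
  by rewrite big1 ?mul0r// => j _; rewrite mxE ki scale0r.
have -> : x - gb M = (u - \sum_j b j *: gamma ^+ j) * (c *: beta ^+ i).
  by rewrite mulrBl divfK// gbM.
by rewrite absvalM vcb ler_wpM2r ?absval_ge0//; exact: absval_discrete.
Qed.

(** Iterating [gb_sum_approx] gives remainders that decay geometrically and coordinates that are
    Cauchy at the same rate; [gb_sum_le] carries their limit over to [K]. *)
Lemma gb_sum_surj (x : K) : exists b, x = gb b.
Proof.
have [A AP] := choice gb_sum_approx.
pose X n := iter n (fun y => y - gb (A y)) x.
have Xw n : v (X n) <= v x * w^-1 ^+ n.
  elim: n => [|n IH]; first by rewrite expr0 mulr1.
  apply: le_trans (AP (X n)).2 _; rewrite exprS mulrCA ler_wpM2l// invr_ge0.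
  exact: ltW.
have winv : 0 <= w^-1 <= 1 by rewrite invr_ge0 ltW//= invf_le1// ltW.
pose S n := \sum_(0 <= k < n) A (X k).
have XS n : X n = x - gb (S n).
  elim: n => [|n IH]; rewrite /S.
    by rewrite big_geq// gb_sum0 subr0.
  by rewrite big_nat_recr//= gb_sumD opprD addrA -IH.
pose r n := v x * w^-1 ^+ n.
have r0 : r n @[n --> \oo] --> 0.
  rewrite -[0](mulr0 (v x)); apply: cvgM; first exact: cvg_cst.
  by apply: cvg_expr; rewrite ger0_norm ?invf_lt1// invr_ge0 ltW.
have lim_ij (ij : 'I_e * 'I_f) : exists l, forall n, vQ (l - S n ij.1 ij.2) <= r n.
  apply: (padic_limit p_prime QpP r0) => n m nm.
  rewrite /S (big_cat_nat _ nm)//= mxE addrAC subrr add0r summxE big_nat.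
  apply: ultra_sum_le => //; first by rewrite mulr_ge0 ?absval_ge0 ?exprn_ge0; case/andP: winv.
  move=> k /andP[nk _]; apply: le_trans ((AP _).1 _ _) _; apply: le_trans (Xw k) _.
  by rewrite ler_wpM2l ?absval_ge0// ler_wiXn2l//; case/andP: winv.
have [l lP] := choice lim_ij; exists (\matrix_(i, j) l (i, j)).
set B := \matrix_(i, j) _; apply/eqP; rewrite -subr_eq0 -(absval_eq0 v).
have rge0 n : 0 <= r n by rewrite mulr_ge0 ?absval_ge0 ?exprn_ge0; case/andP: winv.
have bnd n : v (x - gb B) <= pR * r n.
  rewrite -(subrKA (gb (S n))) -XS; apply: ultra_le => //.
    by apply: le_trans (Xw n) _; rewrite -/(r n) ler_peMl ?rge0// ltW.
  by rewrite -gb_sumB; apply: gb_sum_le => // i j; rewrite !mxE absvalB; exact: (lP (i, j)).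
rewrite eq_le absval_ge0 andbT.
have pr0 : pR * r n @[n --> \oo] --> 0.
  by rewrite -[0](mulr0 pR); apply: cvgM => //; exact: cvg_cst.
by rewrite -(cvg_lim (@Rhausdorff R) pr0); apply: limr_ge;
  [apply/cvg_ex; exists 0|near=> n; exact: bnd].
Unshelve. all: by end_near.
Qed.

(** * The floor on K *)

Local Notation fl := (@field_floor p Qp R vQ K e f gamma beta).
Let pf := padic_floor p vQ.

Lemma field_floorE b : fl (gb b) = gb (map_mx pf b).
Proof.
rewrite /field_floor; case: xgetP => [y _ [c [/gb_sum_inj <- ->]]//|].
by move=> /(_ (gb (map_mx pf b))) []; exists b.
Qed.

Lemma field_floor_sub (x : K) : v (x - fl x) < 1.
Proof.
have [b ->] := gb_sum_surj x; rewrite field_floorE -gb_sumB.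
apply/gb_sum_lt1 => i j; rewrite !mxE.
by have [N [M []]] := padic_floorP p_prime QpP (b i j).
Qed.

Lemma field_floor_uniq (x y : K) : v (fl x - fl y) < 1 -> fl x = fl y.
Proof.
have [b ->] := gb_sum_surj x; have [c ->] := gb_sum_surj y.
rewrite !field_floorE -gb_sumB => /gb_sum_lt1 h; congr gb; apply/matrixP => i j.
by rewrite !mxE; apply: (padic_floor_uniq p_prime QpP); have := h i j; rewrite !mxE.
Qed.

Lemma countable_field_floor : countable (range fl).
Proof.
pose F (M : 'M[nat * nat]_(e, f)) :=
  gb (map_mx (fun z => z.2%:R * p%:R ^ (- z.1%:Z)) M).
apply: (@sub_countable _ _ _ (range F)); last first.
  exact: sub_countable (card_image_le _ _) (countableP _).
apply: subset_card_le => _ [x _ <-]; have [b ->] := gb_sum_surj x.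
rewrite field_floorE.
have [z zP] := choice (fun ij : 'I_e * 'I_f => padic_floor_rat p_prime QpP (b ij.1 ij.2)).
exists (\matrix_(i, j) z (i, j)) => //; congr gb; apply/matrixP => i j.
by rewrite !mxE -(zP (i, j)).
Qed.

End LocalFieldBasis.

(** * Borel sets and image measures *)

Section ValuedBorel.
Context (K : fieldType) (R : realType) (v : absval K R).

Lemma open_valued (A : set (valued v)) :
  (forall x : K, A x -> exists2 r : R, 0 < r & forall y : K, v (y - x) < r -> A y) -> open A.
Proof.
move=> AP; rewrite openE => x /AP[r r0 rA]; apply/nbhs_ballP; exists r => //.
by move=> y; rewrite valued_ballE/= absvalB; exact: rA.
Qed.

Lemma valued_openP (A : set (valued v)) (x : K) : open A -> A x ->
  exists2 r : R, 0 < r & forall y : K, v (y - x) < r -> A y.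
Proof.
rewrite openE => /[apply] /nbhs_ballP[r r0 rA]; exists r => // y yx; apply: rA.
by rewrite valued_ballE/= absvalB.
Qed.

Lemma open_measurable_valued (A : set (valued v)) :
  open A -> measurable (A : set (borel v)).
Proof. exact: sub_sigma_algebra. Qed.

Lemma measurable_valued_set1 (x : K) : measurable ([set x] : set (borel v)).
Proof.
rewrite -[[set x]]setCK; apply: measurableC; apply: open_measurable_valued.
apply: open_valued => y /= /eqP yx; exists (v (x - y)).
  by rewrite absval_gt0 subr_eq0 eq_sym.
by move=> z zy /= zx; rewrite zx ltxx in zy.
Qed.

(** Meant for preimages under maps built from inversion, which is continuous away from 0: such a set
    is open up to one point, itself a Borel set. *)
Lemma measurable_valued_off0 (A : set (borel v)) :
  (forall x : K, A x -> x != 0 -> exists2 r : R, 0 < r & forall y : K, v (y - x) < r -> A y) ->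
  measurable A.
Proof.
move=> AP; rewrite -(setUIDK A [set 0 : K]); apply: measurableU.
  have [A0|A0] := pselect (A 0).
    rewrite setIidr; first exact: measurable_valued_set1.
    by move=> _ ->.
  rewrite (_ : _ `&` _ = set0); first exact: measurable0.
  by apply/seteqP; split => // x [Ax x0]; apply: A0; rewrite -x0.
apply: open_measurable_valued; apply: open_valued => x [Ax /eqP x0].
have [r r0 rA] := AP x Ax x0; exists (Num.min r (v x)).
  by rewrite lt_min r0 absval_gt0.
move=> y; rewrite lt_min => /andP[yr yx]; split; first exact: rA.
by move=> y0; move: yx; rewrite y0 sub0r absvalN ltxx.
Qed.

End ValuedBorel.

Section PushforwardMeasure.
Context d1 d2 (X : measurableType d1) (Y : measurableType d2) (R : realFieldType).

Lemma pushforward_is_measure (m : {measure set X -> \bar R}) (phi : X -> Y) :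
  measurable_fun [set: X] phi ->
  exists m' : {measure set Y -> \bar R}, forall B, m' B = m (phi @^-1` B).
Proof.
move=> mphi.
by unshelve eexists (pushforward m phi : {measure set Y -> \bar R}).
Qed.

End PushforwardMeasure.

(** * Haar measure of balls *)

(* [fl] abstracts [field_floor]: [K] is the disjoint union of the translates by
   the values of [fl] of the open unit ball. *)
Section FloorMap.
Context (K : fieldType) (R : realType) (v : absval K R) (vU : ultrametric v).
Context (fl : K -> K) (fl_sub : forall x, v (x - fl x) < 1).
Context (fl_uniq : forall x y, v (fl x - fl y) < 1 -> fl x = fl y).
Context (fl_countable : countable (range fl)).
Context (beta : K) (beta1 : 1 < v beta).
Context (mu : {measure set (borel v) -> \bar R}).
Context (mu_trans : forall (x : K) (A : set (borel v)), measurable A ->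
  mu [set (x + y : K) | y in (A : set K)] = mu A).
Context (mu1 : mu (unit_ball v) = 1%E).

Lemma floor_eq x y : fl x = fl y <-> v (x - y) < 1.
Proof.
split=> xy.
  have -> : x - y = (x - fl x) - (y - fl y) by rewrite xy; ring.
  exact: ultra_ltB.
apply: fl_uniq; have -> : fl x - fl y = ((y - fl y) - (x - fl x)) + (x - y) by ring.
by apply: ultra_lt => //; exact: ultra_ltB.
Qed.

(** Numbers the cosets of the open unit ball, so that partitions become sequences and countable
    additivity applies. *)
Lemma floor_idx : exists idx : K -> nat, forall x y, idx x = idx y <-> v (x - y) < 1.
Proof.
have /countable_injP[i iinj] := fl_countable.
exists (i \o fl) => x y; rewrite -floor_eq /=; split=> [|->//].
by apply: iinj; rewrite inE; [exists x|exists y].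
Qed.

Let idx : K -> nat := sval (cid floor_idx).
Let idxP x y : idx x = idx y <-> v (x - y) < 1.
Proof. exact: (svalP (cid floor_idx)). Qed.

Let oball (x : K) (r : R) : set (borel v) := [set y : K | v (y - x) < r].

Lemma measurable_oball x r : measurable (oball x r).
Proof.
apply: open_measurable_valued; apply: open_valued => y yx.
have r0 : 0 < r by apply: le_lt_trans yx; exact: absval_ge0.
by exists r => // z zy; rewrite /oball/= -(subrKA y); exact: ultra_lt.
Qed.
Hint Resolve measurable_oball : core.

(** For [z != 0], the [n]-th coset of the open ball of radius [v z], got by scaling those of the
    unit ball; empty when [idx] omits [n]. *)
Let lvl (z : K) (n : nat) : set (borel v) := [set x : K | idx (x / z) = n].

Lemma lvlP (z x : K) n : z != 0 -> lvl z n x -> lvl z n = oball x (v z).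
Proof.
move=> z0 xn; apply/seteqP; split=> y /=; rewrite /oball /lvl/= -xn idxP -mulrBl absvalM absvalV.
  by rewrite ltr_pdivrMr ?mul1r// absval_gt0.
by rewrite ltr_pdivrMr ?mul1r// absval_gt0.
Qed.

Lemma measurable_lvl z n : z != 0 -> measurable (lvl z n).
Proof.
move=> z0; have [->|/set0P[x /(lvlP z0)->//]] := eqVneq (lvl z n) set0.
exact: measurable0.
Qed.

Lemma trivIset_lvl z : trivIset setT (lvl z).
Proof. by move=> i j _ _ [x []]; rewrite /lvl/= => <- <-. Qed.

Lemma bigcup_lvl z : \bigcup_n lvl z n = setT.
Proof. by apply/seteqP; split => // x _; exists (idx (x / z)). Qed.

Lemma measure_oball x r : mu (oball x r) = mu (oball 0 r).
Proof.
rewrite -(mu_trans x (measurable_oball 0 r)); congr (mu _).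
apply/seteqP; split=> y; rewrite /oball/=.
  by move=> yx; exists (y - x); rewrite ?subr0// subrKC.
by move=> [z]; rewrite subr0 => zr <-; rewrite addrC addKr.
Qed.

Lemma unit_ballE : unit_ball v = oball 0 1.
Proof. by apply/seteqP; split=> x; rewrite /unit_ball /oball/= subr0. Qed.

Let m (r : R) : \bar R := mu (oball 0 r).

Let m_one : m 1 = 1%E.
Proof. by rewrite /m -unit_ballE. Qed.

Lemma measure_oball_fin r : r <= 1 -> m r \is a fin_num.
Proof.
move=> r1; rewrite ge0_fin_numE//; apply: (@le_lt_trans _ _ (m 1)); last by rewrite m_one ltry.
by apply: le_measure; rewrite ?inE// => x xr; apply: lt_le_trans r1.
Qed.

(* The unit ball and its image under [t] have the same number of cosets
   modulo the balls of radius [v z] and [v t * v z] respectively. *)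
Lemma measure_oballM (t z : K) : t != 0 -> z != 0 -> v t <= 1 -> v z <= 1 ->
  m (v t * v z) = (m (v t) * m (v z))%E.
Proof.
move=> t0 z0 t1 z1.
pose N := [set n : nat | exists2 x, v x < 1 & idx (x / z) = n].
(* The number of cosets of the smaller ball in the unit ball, a priori possibly infinite. *)
pose S := (\sum_(n <oo) (\1_N n)%:E : \bar R)%E.
have key s : s != 0 -> v s <= 1 -> m (v s) = (m (v s * v z) * S)%E.
  move=> s0 s1; have sz0 : s * z != 0 by rewrite mulf_neq0.
  have fin : m (v s * v z) \is a fin_num.
    by apply: measure_oball_fin; rewrite mulr_ile1 ?absval_ge0.
  rewrite /S -(fineK fin) -nneseriesZl; last by move=> n _; rewrite lee_fin.
  rewrite fineK// /m -[X in mu X = _](setIT) -(bigcup_lvl (s * z)) setI_bigcupr.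
  rewrite measure_bigcup//=; last 2 first.
  - by move=> i _; apply: measurableI => //; exact: measurable_lvl.
  - by apply: trivIset_setIl; exact: trivIset_lvl.
  rewrite [LHS]eseries_mkcond; apply: eq_eseriesr => n _; rewrite in_setT.
  have [nN|nN] := pselect (N n).
    rewrite indicE mem_set// mule1; have [x x1 xn] := nN.
    have lx : lvl (s * z) n (s * x).
      by rewrite /lvl/= invfM mulrACA divff// mul1r.
    rewrite (lvlP sz0 lx) setIidr ?absvalM ?measure_oball//.
    move=> y; rewrite /oball/= subr0 => yx; rewrite -[y](subrK (s * x)).
    apply: ultra_lt => //; last by rewrite absvalM gtr_pMr ?absval_gt0.
    by apply: lt_le_trans yx _; rewrite ler_piMr ?absval_ge0.
  rewrite indicE memNset// mule0 (_ : _ `&` _ = set0) ?measure0//.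
  apply/seteqP; split => // y []; rewrite /oball /lvl/= subr0 => ys yn; apply: nN.
  exists (y / s); first by rewrite absvalM absvalV ltr_pdivrMr ?mul1r ?absval_gt0.
  by rewrite -yn invfM mulrA.
rewrite (key t)// muleAC -muleA.
(* The case [s = 1] reads [1 = m (v z) * S], which eliminates [S]. *)
have := key 1 (oner_neq0 _); rewrite absval1 mul1r m_one => /(_ (lexx _)) <-.
by rewrite mule1.
Qed.

(** The points [beta ^- n.+1] are infinitely many distinct translates of 0 inside a set of measure
    1. *)
Lemma measure_valued0 : mu [set (0 : K)] = 0%E.
Proof.
have b0 : beta != 0 by rewrite -(absval_gt0 v) (lt_trans ltr01).
pose F n : set (borel v) := [set beta ^- n.+1].
have vF n : v (beta ^- n.+1) < 1.
  by rewrite absvalV absvalX invf_lt1 ?exprn_gt0 ?exprn_egt1// (lt_trans ltr01).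
have tF : trivIset setT F.
  move=> i j _ _ [x [/= -> /(congr1 v)]]; rewrite !absvalV !absvalX => /invr_inj.
  by move=> /(ieexprIn (lt_trans ltr01 beta1) (negbT (gt_eqF beta1)))[].
have mF n : mu (F n) = mu [set (0 : K)].
  rewrite -(mu_trans (beta ^- n.+1) (@measurable_valued_set1 K R v 0)); congr (mu _).
  by rewrite image_set1 addr0.
have : (mu (\bigcup_n F n) <= 1)%E.
  rewrite -mu1 unit_ballE; apply: le_measure; rewrite ?inE//.
    by apply: bigcup_measurable => n _; exact: measurable_valued_set1.
  by move=> _ [n _ ->]; rewrite /oball/= subr0.
rewrite measure_bigcup//; last by move=> *; exact: measurable_valued_set1.
under eq_eseriesr do rewrite mF; under eq_eseriesl do rewrite in_setT.
move=> le1; set c := mu [set 0]; have c0 : (0 <= c)%E by exact: measure_ge0.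
have cN N : (\sum_(0 <= i < N) c <= 1)%E.
  by apply: le_trans le1; exact: nneseries_lim_ge.
have fin : c \is a fin_num.
  by rewrite ge0_fin_numE//; have := cN 1%N; rewrite big_nat1 => /le_lt_trans; apply; rewrite ltry.
rewrite -(fineK fin); congr (_%:E).
apply/eqP; rewrite eq_le fine_ge0// andbT leNgt; apply/negP => cpos.
have := archi_boundP (ltW (divr_gt0 (@ltr01 R) cpos)); set N := Num.bound _.
rewrite ltr_pdivrMr// => cN1; have := cN N.
by rewrite -(fineK fin) sumEFin lee_fin sumr_const_nat subn0 leNgt -mulr_natl cN1.
Qed.

(** * The map T and its fibres *)

Definition floor_map (x : borel v) : borel v :=
  if (x : K) == 0 then 0 : K else (x : K)^-1 - fl (x : K)^-1.
Local Notation T := floor_map.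

(** Since [1/y - 1/x = (x - y) / (x y)] and [v] is constant on a ball avoiding 0, inversion is a
    similarity there. *)
Lemma absval_sub_inv (x y : K) : x != 0 -> v (y - x) < v x ->
  v (y^-1 - x^-1) = v (y - x) / v x ^+ 2.
Proof.
move=> x0 yx; have vy : v y = v x by apply: ultra_eq; rewrite // absvalB.
have y0 : y != 0 by rewrite -(absval_gt0 v) vy absval_gt0.
have -> : y^-1 - x^-1 = (x - y) / (x * y) by field; rewrite y0 x0.
by rewrite absvalM absvalV absvalM vy absvalB expr2.
Qed.

Lemma floor_inv_locally_constant (x : K) : x != 0 -> exists2 r : R, 0 < r &
  forall y : K, v (y - x) < r -> [/\ y != 0, v y = v x, fl y^-1 = fl x^-1 &
    v (y^-1 - x^-1) = v (y - x) / v x ^+ 2].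
Proof.
move=> x0; have vx : 0 < v x by rewrite absval_gt0.
(* The first radius ensures [v y = v x]; the second puts [y^-1] within 1 of [x^-1]. *)
exists (Num.min (v x) (v x ^+ 2)); first by rewrite lt_min vx exprn_gt0.
move=> y; rewrite lt_min => /andP[yx yx2]; have E := absval_sub_inv x0 yx.
have vy : v y = v x by apply: ultra_eq; rewrite // absvalB.
split => //; first by rewrite -(absval_gt0 v) vy.
by apply/floor_eq; rewrite E ltr_pdivrMr ?mul1r ?exprn_gt0.
Qed.

Lemma measurable_floor_map : measurable_fun [set: borel v] T.
Proof.
apply: measurability => // _ [U oU <-]; rewrite setTI.
apply: measurable_valued_off0 => x Ux x0.
have [r r0 rP] := floor_inv_locally_constant x0.
have [r' r'0 UP] := valued_openP oU Ux; have vx : 0 < v x by rewrite absval_gt0.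
exists (Num.min r (r' * v x ^+ 2)); first by rewrite lt_min r0 mulr_gt0// exprn_gt0.
move=> y; rewrite lt_min => /andP[/rP[y0 vy fly E] yx]; apply: UP.
rewrite /floor_map (negPf y0) (negPf x0) fly.
have -> : y^-1 - fl x^-1 - (x^-1 - fl x^-1) = y^-1 - x^-1 by ring.
by rewrite E ltr_pdivrMr ?exprn_gt0.
Qed.

(** The sets [c_1 = c], numbered by the coset of [x^-1]. One of them is the singleton of 0, as
    [0^-1 = 0] while nonzero points of the unit ball have inverses of value above 1. *)
Let A (n : nat) : set (borel v) := unit_ball v `&` [set x : K | idx x^-1 = n].

Lemma measurable_unit_ball : measurable (unit_ball v : set (borel v)).
Proof. by rewrite unit_ballE. Qed.
Let mB0 := measurable_unit_ball.

Lemma measurable_floor_fiber (P : set K) :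
  measurable ([set x : K | P (fl x^-1)] : set (borel v)).
Proof.
apply: measurable_valued_off0 => x Px x0.
have [r r0 rP] := floor_inv_locally_constant x0; exists r => // y /rP[_ _ flE _].
by rewrite /= flE.
Qed.

Let mA n : measurable (A n).
Proof.
apply: measurableI => //.
have [[x xn]|none] := pselect (exists x, idx x = n); last first.
  rewrite (_ : mkset _ = set0); first exact: measurable0.
  by apply/seteqP; split => // x /= xn; apply: none; exists x^-1.
rewrite (_ : mkset _ = [set y : K | fl y^-1 = fl x]).
  exact: (measurable_floor_fiber [set z | z = fl x]).
by apply/seteqP; split=> y /=; rewrite -xn floor_eq idxP.
Qed.

Lemma floor_map_unit_ball x : unit_ball v (T x).
Proof.
by rewrite /unit_ball /floor_map/=; case: ifP => _; rewrite ?absval0.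
Qed.

(** The inverse branch of [T] on [c_1 = c] is [t |-> (c + t)^-1]. It scales distances by exactly
    [v c ^- 2], because [v (c + t) = v c] for [v t < 1]. *)
Lemma fiber_oball (x0 y z : K) : x0 != 0 -> v x0 < 1 -> v y < 1 -> z != 0 -> v z <= 1 ->
  A (idx x0^-1) `&` T @^-1` oball y (v z) =
  oball (fl x0^-1 + y)^-1 (v z * v ((fl x0^-1) ^- 2)).
Proof.
move=> x00 x01 y1 z0 z1; set c := fl x0^-1.
have vx0 : 0 < v x0 by rewrite absval_gt0.
have vx0V : 1 < v x0^-1 by rewrite absvalV invf_gt1.
have vc : v c = v x0^-1.
  by apply: ultra_eq => //; apply: lt_trans vx0V; exact: fl_sub.
have c1 : 1 < v c by rewrite vc.
have c0 : c != 0 by rewrite -(absval_gt0 v) (lt_trans ltr01).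
have vcD t : v t < 1 -> v (c + t) = v c.
  move=> t1; apply: ultra_eq => //.
  by rewrite opprD addrA subrr sub0r absvalN (lt_trans t1).
have cD0 t : v t < 1 -> c + t != 0.
  by move=> /vcD ct; rewrite -(absval_gt0 v) ct (lt_trans ltr01).
have vz : 0 < v z by rewrite absval_gt0.
have vcp : 0 < v c by rewrite (lt_trans ltr01).
apply/seteqP; split=> x.
  move=> [[x1 /= /idxP xx0]]; rewrite /oball/= => Txy.
  have x_neq0 : x != 0 :> K.
    apply: contraTneq xx0 => ->; rewrite invr0 sub0r absvalN -leNgt.
    exact: ltW.
  have flx : fl x^-1 = c by apply/floor_eq.
  have xE : (x : K) = (c + T x)^-1.
    by rewrite /floor_map (negPf x_neq0) flx subrKC invrK.
  have Tx1 := floor_map_unit_ball x; rewrite /unit_ball/= in Tx1.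
  have -> : (x : K) - (c + y)^-1 = (y - T x) / ((c + T x) * (c + y)).
    by rewrite {1}xE; field; rewrite !cD0.
  rewrite absvalM absvalV absvalM !vcD// absvalV absvalX absvalB -expr2.
  by rewrite ltr_pM2r ?invr_gt0 ?exprn_gt0.
rewrite /oball/= => xy.
have cy0 := cD0 _ y1; have vcy := vcD _ y1.
have lt2 : v ((x : K) - (c + y)^-1) < v (c + y)^-1.
  apply: lt_le_trans xy _; rewrite !absvalV absvalX vcy expr2 invfM mulrA.
  rewrite ler_piMl ?invr_ge0 ?ltW// ltr_pdivrMr// mul1r.
  exact: le_lt_trans z1 c1.
have x_neq0 : x != 0 :> K.
  by apply: contraTneq lt2 => ->; rewrite sub0r absvalN ltxx.
have vx : v x = (v c)^-1.
  by rewrite -vcy -absvalV; apply: ultra_eq; rewrite // absvalB.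
have E : v ((x : K)^-1 - (c + y)) < v z.
  rewrite -{1}[c + y]invrK absval_sub_inv ?invr_eq0//.
  rewrite absvalV exprVn invrK vcy -ltr_pdivlMr ?exprn_gt0//.
  by move: xy; rewrite absvalV absvalX.
have flx : fl x^-1 = c.
  rewrite /c; apply/floor_eq.
  have -> : (x : K)^-1 - x0^-1 = (x^-1 - (c + y)) + y - (x0^-1 - fl x0^-1).
    by rewrite /c; ring.
  apply: ultra_ltB => //; apply: ultra_lt => //; exact: lt_le_trans E z1.
split; first split.
- by rewrite /unit_ball/= vx invf_lt1.
- by apply/idxP/floor_eq.
- by rewrite /floor_map (negPf x_neq0) flx -addrA -opprD.
Qed.

(** Only the radii [v (beta ^- k)] occur: this leaves countably many balls, any two of them nested
    or disjoint. The empty set is added for closure under intersection. *)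
Let G : set (set (borel v)) :=
  [set D | D = set0 \/ exists k n, D = lvl (beta ^- k) n].

Let b0 : beta != 0.
Proof. by rewrite -(absval_gt0 v) (lt_trans ltr01). Qed.

Let bk0 k : beta ^- k != 0.
Proof. by rewrite invr_eq0 expf_neq0. Qed.

Let vbk k : v (beta ^- k) <= 1.
Proof.
by rewrite absvalV absvalX invf_le1 ?exprn_gt0 ?exprn_ege1 ?(ltW beta1)// (lt_trans ltr01).
Qed.

Lemma setI_closed_lvl : setI_closed G.
Proof.
move=> D E [->|[k [n ->]]]; first by left; rewrite set0I.
move=> [->|[l [j ->]]]; first by left; rewrite setI0.
have [->|/set0P[x [xk xl]]] := eqVneq (lvl (beta ^- k) n `&` lvl (beta ^- l) j) set0.
  by left.
have sub a b i i' : (a <= b)%N -> lvl (beta ^- a) i x -> lvl (beta ^- b) i' x ->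
    lvl (beta ^- b) i' `<=` lvl (beta ^- a) i.
  move=> ab xa xb; rewrite (lvlP (bk0 a) xa) (lvlP (bk0 b) xb) => y; rewrite /oball/= => yb.
  apply: lt_le_trans yb _; rewrite !absvalV !absvalX lef_pV2 ?posrE ?exprn_gt0 ?(lt_trans ltr01)//.
  by rewrite ler_eXn2l.
right; have [kl|/ltnW lk] := leqP k l.
  by exists l, j; rewrite setIidr//; exact: sub xk xl.
by exists k, n; rewrite setIidl//; exact: sub xl xk.
Qed.

Lemma borel_generated_lvl : @measurable _ (borel v) = <<s G >>.
Proof.
apply/seteqP; split; last first.
  apply: smallest_sub; first exact: sigma_algebra_measurable.
  by move=> _ [->|[k [n ->]]]; [exact: measurable0|exact: measurable_lvl].
apply: smallest_sub; first exact: smallest_sigma_algebra.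
move=> O oO.
have -> : O = \bigcup_k \bigcup_(n in [set n | lvl (beta ^- k) n `<=` O]) lvl (beta ^- k) n.
  apply/seteqP; split=> [x Ox|x [k _ [n /= nO xn]]]; last exact: nO.
  have [r r0 rO] := valued_openP oO Ox.
  have [k kr] : exists k, v (beta ^- k) < r.
    have : (v beta)^-1 ^+ k @[k --> \oo] --> 0.
      apply: cvg_expr; rewrite ger0_norm ?invf_lt1 ?invr_ge0 ?absval_ge0//.
      exact: lt_trans beta1.
    move=> /cvgr_lt/(_ _ r0)[k _ /(_ k (leqnn k))] /= kr; exists k.
    by rewrite absvalV absvalX -exprVn.
  exists k => //; exists (idx (x / beta ^- k)); last by [].
  have xk : lvl (beta ^- k) (idx (x / beta ^- k)) x by [].
  by rewrite /= (lvlP (bk0 k) xk) => y yx; apply: rO; exact: lt_trans kr.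
apply: sigma_algebra_bigcup => k; rewrite bigcup_mkcond.
apply: sigma_algebra_bigcup => n; apply: sub_gen_smallest.
by case: ifP => _; [right; exists k, n|left].
Qed.

Let measure_fiber n : A n = set0 \/ A n = [set (0 : K)] \/
  exists x0 : K, [/\ x0 != 0, v x0 < 1 & A n = A (idx x0^-1)].
Proof.
have [A0|/set0P[x [x1 xn]]] := eqVneq (A n) set0; first by left.
right; rewrite /= in xn; have [x0|x0] := eqVneq (x : K) 0; last first.
  by right; exists x; rewrite -xn.
left; apply/seteqP; split=> [y [y1 /= yn]|_ ->].
  apply: contrapT => /eqP y0; move: yn; rewrite -xn x0 invr0 idxP subr0 absvalV.
  by rewrite invf_lt1 ?absval_gt0// ltNge ltW.
by split; rewrite /unit_ball/= ?absval0// -xn x0.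
Qed.

Lemma measure_fiber_floor_map n (B : set (borel v)) : measurable B ->
  mu (A n `&` T @^-1` B) = (mu (A n) * mu (B `&` unit_ball v))%E.
Proof.
move=> mB; have [A0|[A0|[x0 [x00 x01 AE]]]] := measure_fiber n.
- by rewrite A0 set0I measure0 mul0e.
- have mT := measurable_floor_map.
  have := measure_valued0; rewrite A0 => mu0; rewrite mu0 mul0e.
  apply/eqP; rewrite eq_le measure_ge0 andbT -{1}mu0; apply: le_measure; rewrite ?inE//.
    apply: measurableI; first exact: measurable_valued_set1.
    by rewrite -[X in measurable X]setTI; exact: mT.
  exact: measurable_valued_set1.
rewrite AE.
set c := fl x0^-1.
have vx0V : 1 < v x0^-1 by rewrite absvalV invf_gt1 ?absval_gt0.
have vc : v c = v x0^-1.
  by apply: ultra_eq => //; apply: lt_trans vx0V; exact: fl_sub.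
have c1 : 1 < v c by rewrite vc.
have c0 : c != 0 by rewrite -(absval_gt0 v) (lt_trans ltr01).
have c20 : c ^- 2 != 0 by rewrite invr_eq0 expf_neq0.
have vc2 : v (c ^- 2) <= 1.
  by rewrite absvalV absvalX invf_le1 ?exprn_gt0 ?exprn_ege1 ?(ltW c1)// (lt_trans ltr01).
have ball_case y z : v y < 1 -> z != 0 -> v z <= 1 ->
    mu (A (idx x0^-1) `&` T @^-1` oball y (v z)) = (m (v (c ^- 2)) * m (v z))%E.
  move=> y1 z0 z1; rewrite fiber_oball// measure_oball mulrC.
  by rewrite -measure_oballM.
have fullT : T @^-1` oball 0 1 = setT.
  by apply/seteqP; split => // x _; rewrite -unit_ballE; exact: floor_map_unit_ball.
(* The ball of radius 1 pulls back to everything, which gives the measure of the fibre itself. *)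
have muA : mu (A (idx x0^-1)) = m (v (c ^- 2)).
  have := @ball_case 0 1; rewrite !absval1 absval0 fullT setIT m_one mule1.
  by apply; rewrite ?oner_neq0.
rewrite muA; have fin := measure_oball_fin vc2.
have [m1 m1E] : exists m1 : {measure set (borel v) -> \bar R},
    forall B, m1 B = mu (A (idx x0^-1) `&` T @^-1` B).
  have [m' m'E] := pushforward_is_measure (mrestr mu (mA (idx x0^-1))) measurable_floor_map.
  by exists m' => D; rewrite m'E /= /mrestr setIC.
pose r : {nonneg R} := NngNum (fine_ge0 (measure_ge0 mu (oball 0 (v (c ^- 2))))).
pose m2 : {measure set (borel v) -> \bar R} := mscale r (mrestr mu mB0).
have m2E D : m2 D = (m (v (c ^- 2)) * mu (D `&` unit_ball v))%E.
  by rewrite /m2/= /mscale/= /mrestr fineK.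
rewrite -m1E -m2E; apply: (measure_unique G (lvl 1)) => //.
- exact: borel_generated_lvl.
- exact: setI_closed_lvl.
- by move=> n'; right; exists 0%N, n'; rewrite expr0 invr1.
- exact: bigcup_lvl.
- move=> D; rewrite m1E m2E => -[->|[k [j ->]]].
    by rewrite preimage_set0 setI0 set0I measure0 mule0.
  (* A ball of radius at most 1 is either disjoint from the unit ball, hence never reached by [T],
     or contained in it. *)
  have [E|/set0P[y [yj y1]]] := eqVneq (lvl (beta ^- k) j `&` unit_ball v) set0.
    rewrite E measure0 mule0 (_ : _ `&` _ = set0) ?measure0//.
    apply/seteqP; split => // x [_ xT].
    by have : set0 (T x) by rewrite -E; split => //; exact: floor_map_unit_ball.
  rewrite (lvlP (bk0 k) yj) ball_case// setIidl ?measure_oball//.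
  move=> x; rewrite /oball /unit_ball/= => xy; rewrite -(subrK y x).
  by apply: ultra_lt => //; exact: lt_le_trans xy (vbk k).
- move=> j; rewrite m1E; apply: (@le_lt_trans _ _ 1%E); last by rewrite ltry.
  rewrite -mu1; apply: le_measure; rewrite ?inE//.
    apply: measurableI => //; rewrite -[X in measurable X]setTI.
    apply: measurable_floor_map => //; apply: measurable_lvl.
    exact: oner_neq0.
  by move=> x [[]].
Qed.

Lemma bigcup_fiber : \bigcup_n A n = unit_ball v.
Proof.
by apply/seteqP; split=> [x [n _ []]//|x x1]; exists (idx x^-1).
Qed.

Lemma trivIset_fiber : trivIset setT A.
Proof. by move=> i j _ _ [x [[_ /= <-] [_ /= <-]]]. Qed.

(** Sum the product formula over the fibres, whose measures add up to 1. *)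
Lemma measure_floor_map (B : set (borel v)) : measurable B ->
  mu (T @^-1` B `&` unit_ball v) = mu (B `&` unit_ball v).
Proof.
move=> mB; have mTB : measurable (T @^-1` B).
  by rewrite -[X in measurable X]setTI; exact: measurable_floor_map.
have fin : mu (B `&` unit_ball v) \is a fin_num.
  rewrite ge0_fin_numE//; apply: (@le_lt_trans _ _ 1%E); last by rewrite ltry.
  by rewrite -mu1; apply: le_measure; rewrite ?inE//; exact: measurableI.
rewrite -{1}bigcup_fiber setI_bigcupr measure_bigcup//=; last 2 first.
- by move=> *; exact: measurableI.
- by apply: trivIset_setIl; exact: trivIset_fiber.
under eq_eseriesr do rewrite setIC measure_fiber_floor_map// muleC -(fineK fin).
rewrite nneseriesZl//.
have := mu1; rewrite -{1}bigcup_fiber measure_bigcup//; last exact: trivIset_fiber.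
by move=> ->; rewrite mule1 fineK.
Qed.

Lemma floor_map_partition : exists P : nat -> set (borel v),
  [/\ forall n, measurable (P n), trivIset setT P, \bigcup_n P n = unit_ball v,
      forall n B, measurable B ->
        mu (P n `&` T @^-1` B) = (mu (P n) * mu (B `&` unit_ball v))%E &
      forall n (x y : K), P n x -> P n y -> fl x^-1 = fl y^-1].
Proof.
exists A; split=> // [|||n x y [_ /= xn] [_ /= yn]].
- exact: trivIset_fiber.
- exact: bigcup_fiber.
- exact: measure_fiber_floor_map.
- by apply/floor_eq/idxP; rewrite xn.
Qed.

End FloorMap.

(** * Change of variables and square integrability *)

Section IntegralTransfer.
Context d1 d2 (X : measurableType d1) (Y : measurableType d2) (R : realType).
Context (m : {measure set X -> \bar R}) (m' : {measure set Y -> \bar R}).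
Context (phi : X -> Y) (mphi : measurable_fun [set: X] phi).
Context (m'E : forall B, measurable B -> m' B = m (phi @^-1` B)).
Local Open Scope ereal_scope.

(** [m'] is only required to agree with the image measure, so that invariance under a map and
    independence on an atom both become instances. *)
Lemma ge0_integral_image (f : Y -> \bar R) : measurable_fun [set: Y] f ->
  (forall y, 0 <= f y) -> \int[m']_y f y = \int[m]_x f (phi x).
Proof.
move=> mf f0.
have := @ge0_integral_pushforward _ _ _ _ _ _ mphi m setT f measurableT mf (fun y _ => f0 y).
rewrite preimage_setT => <-.
apply: (@eq_measure_integral _ _ _ _
  (measure_function_pushforward__canonical__measure_function_Measure m mphi)).
by move=> A mA _; exact: m'E.
Qed.

Lemma integral_image (f : Y -> \bar R) : measurable_fun [set: Y] f ->
  \int[m']_y f y = \int[m]_x f (phi x).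
Proof.
move=> mf; rewrite [LHS]integralE [RHS]integralE.
rewrite !ge0_integral_image//.
- by congr (_ - _); apply: eq_integral => x _; rewrite ?funeposE ?funenegE.
- exact: measurable_funeneg.
- exact: measurable_funepos.
Qed.

Lemma integrable_image (f : Y -> \bar R) :
  m'.-integrable setT f -> m.-integrable setT (f \o phi).
Proof.
move=> /integrableP[mf fi]; apply/integrableP; split; first exact: measurableT_comp.
have := @ge0_integral_image (abse \o f); rewrite /comp => <- //.
exact: measurableT_comp.
Qed.

End IntegralTransfer.

Section SquareIntegrable.
Context d (X : measurableType d) (R : realType) (mu : {measure set X -> \bar R}).
Local Open Scope ereal_scope.

Lemma ge0_integral_mrestr (D : set X) (mD : measurable D) (f : X -> \bar R) :
  measurable_fun setT f -> (forall x, 0 <= f x) ->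
  \int[mrestr mu mD]_x f x = \int[mu]_(x in D) f x.
Proof.
move=> mf f0; rewrite [LHS](@ge0_negligible_integral _ _ _ _ _ (~` D))//; last 2 first.
- exact: measurableC.
- by rewrite /= /mrestr setICl measure0.
rewrite setTD setCK; apply: eq_measure_integral => A mA AD.
by rewrite /= /mrestr setIidl.
Qed.

Lemma integral_mrestr (D : set X) (mD : measurable D) (f : X -> \bar R) :
  measurable_fun setT f -> \int[mrestr mu mD]_x f x = \int[mu]_(x in D) f x.
Proof.
move=> mf; rewrite [LHS]integralE [RHS]integralE !ge0_integral_mrestr//.
- exact: measurable_funeneg.
- exact: measurable_funepos.
Qed.

Definition square_integrable (f : X -> R) :=
  measurable_fun setT f /\ mu.-integrable setT (fun x => (f x ^+ 2)%:E).

Lemma square_integrableM (f g : X -> R) : square_integrable f -> square_integrable g ->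
  mu.-integrable setT (fun x => (f x * g x)%:E).
Proof.
move=> [mf f2] [mg g2]; have := integrableD measurableT f2 g2.
apply: le_integrable => //; first by apply/measurable_EFinP; exact: measurable_funM.
move=> x _; rewrite /= lee_fin [leRHS]ger0_norm ?addr_ge0 ?sqr_ge0//.
rewrite normrM -(real_normK (num_real (f x))) -(real_normK (num_real (g x))).
have := sqr_ge0 (`|f x| - `|g x|)%R; have := sqr_ge0 (`|f x| + `|g x|)%R.
by move: `|f x|%R `|g x|%R => a b ? ?; nra.
Qed.

End SquareIntegrable.

Lemma square_integrable_integrable d (X : measurableType d) (R : realType)
    (nu : probability X R) (f : X -> R) :
  square_integrable nu f -> nu.-integrable setT (EFin \o f).
Proof.
move=> f2; have c2 : square_integrable nu (fun=> 1).
  by split => //; exact: finite_measure_integrable_cst.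
by apply: eq_integrable (square_integrableM f2 c2) => // x _ /=; rewrite mulr1.
Qed.

(** * Decorrelation under an invariant map *)

(* [PS] says that the atoms of [P] are independent of [S]: a function [g] constant
   on the atoms gives pairwise independent [g \o iter n S]. *)
Section IndependentFactor.
Context d (X : measurableType d) (R : realType) (nu : probability X R).
Context (S : X -> X) (mS : measurable_fun setT S).
Context (nuS : forall A, measurable A -> nu (S @^-1` A) = nu A).
Context (P : nat -> set X) (mP : forall n, measurable (P n)) (tP : trivIset setT P).
Context (P1 : nu (\bigcup_n P n) = 1%E).
Context (PS : forall n B, measurable B -> nu (P n `&` S @^-1` B) = (nu (P n) * nu B)%E).
Local Open Scope ereal_scope.

Lemma measurable_iter n : measurable_fun setT (iter n S).
Proof.
elim: n => [|n IH]; first exact: measurable_id.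
exact: (measurableT_comp mS IH).
Qed.

Lemma measure_iter n A : measurable A -> nu (iter n S @^-1` A) = nu A.
Proof.
elim: n A => // n IH A mA; rewrite -[RHS]nuS// -[RHS]IH//.
by rewrite -[X in measurable X]setTI; exact: mS.
Qed.

Lemma square_integrable_iter n (f : X -> R) :
  square_integrable nu f -> square_integrable nu (f \o iter n S).
Proof.
move=> [mf f2]; split; first exact: measurableT_comp (measurable_iter n).
apply: (@integrable_image _ _ _ _ _ nu nu (iter n S) _ _ (fun x => (f x ^+ 2)%:E)) => //.
- exact: measurable_iter.
- by move=> B mB; apply/esym/measure_iter.
Qed.

Lemma integral_iter n (f : X -> \bar R) : measurable_fun setT f ->
  \int[nu]_x f (iter n S x) = \int[nu]_x f x.
Proof.
move=> mf; apply/esym; apply: integral_image => //; first exact: measurable_iter.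
by move=> B mB; apply/esym/measure_iter.
Qed.

(** By [PS], the image under [S] of [nu] restricted to [P n] is [nu (P n)] times [nu], so [u \o S]
    has integral 0 on each atom. *)
Lemma integral_fiber_centered n (u : X -> R) : nu.-integrable setT (EFin \o u) ->
  \int[nu]_x (u x)%:E = 0 -> \int[nu]_(x in P n) (u (S x))%:E = 0.
Proof.
move=> ui u0; have mu' := measurable_int _ ui.
rewrite -(integral_mrestr nu (mP n))/=; last exact: (measurableT_comp mu' mS).
pose r : {nonneg R} := NngNum (fine_ge0 (measure_ge0 nu (P n))).
have fin : nu (P n) \is a fin_num by exact: fin_num_measure.
transitivity (\int[mscale r nu]_x (u x)%:E).
  apply/esym; apply: (@integral_image _ _ _ _ _ (mrestr nu (mP n)) _ S mS _ (EFin \o u)) => //.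
  by move=> B mB; rewrite /= /mscale/= /mrestr fineK// setIC; apply/esym/PS.
rewrite integralE !ge0_integral_mscale//; last 2 first.
- exact: measurable_funeneg.
- exact: measurable_funepos.
rewrite -muleBr//; last first.
  by apply: fin_num_adde_defr; apply: integrable_pos_fin_num.
by rewrite -integralE u0 mule0.
Qed.

(** On each atom [h] is a constant factor; the atoms together have full measure. *)
Lemma integral_factor_centered (h u : X -> R) : square_integrable nu h ->
  square_integrable nu u ->
  (forall n x y, P n x -> P n y -> h x = h y) ->
  \int[nu]_x (u x)%:E = 0 -> \int[nu]_x (h x * u (S x))%:E = 0.
Proof.
move=> h2 u2 hP u0.
have ui := square_integrable_integrable u2.
have huS := square_integrableM h2 (square_integrable_iter 1 u2).
have mUP : measurable (\bigcup_n P n) by exact: bigcup_measurable.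
have nuC : nu (~` (\bigcup_n P n)) = 0 by rewrite probability_setC// P1 subee.
rewrite (@negligible_integral _ _ _ _ _ (~` \bigcup_n P n))//; last exact: measurableC.
rewrite setTD setCK integral_bigcup//; last exact: integrableS huS.
rewrite eseries0// => n _ _.
have [->|/set0P[x0 Px0]] := eqVneq (P n) set0; first by rewrite integral_set0.
rewrite (eq_integral (fun x => (h x0)%:E * (u (S x))%:E)); last first.
  by move=> x; rewrite inE => Px; rewrite EFinM (hP n x x0).
rewrite integralZl// ?integral_fiber_centered ?mule0//.
apply: (integrableS measurableT) => //.
by apply: (integrable_image mS _ ui) => B mB; apply/esym/nuS.
Qed.

(** * Averages along the sequence *)

Context (g : {mfun X >-> R}) (g2 : square_integrable nu g).
Context (gP : forall n x y, P n x -> P n y -> g x = g y).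

Let mean : R := (\int[nu]_x g x)%R.
Let h x := (g x - mean)%R.

Let gi := square_integrable_integrable g2.

Let h0 : \int[nu]_x (h x)%:E = 0.
Proof.
rewrite /h; under eq_integral do rewrite EFinB.
rewrite integralB//; last exact: finite_measure_integrable_cst.
have -> : \int[nu]_(x in setT) mean%:E = mean%:E.
  by rewrite integral_cst// -[RHS]mule1; congr (_ * _); exact: probability_setT.
have fin : \int[nu]_x (g x)%:E \is a fin_num by exact: integrable_fin_num gi.
by rewrite /mean /Rintegral fineK// subee.
Qed.

Let h2 : square_integrable nu h.
Proof.
split; first by apply: measurable_funB.
have -> : (fun x => (h x ^+ 2)%:E) =
    (fun x => (g x ^+ 2)%:E) \+ (fun x => (- (mean *+ 2))%:E * (EFin \o g) x)
      \+ cst ((mean ^+ 2)%:E).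
  by apply/funext => x; rewrite /= -!EFinM -!EFinD; congr (_%:E); rewrite /h; ring.
apply: integrableD => //; last exact: finite_measure_integrable_cst.
by apply: integrableD => //; [exact: g2.2|exact: integrableZl].
Qed.

Let sigma2 : R := (\int[nu]_x (h x ^+ 2))%R.

(** Invariance removes [iter i S]. What remains is [h] against a function of [S x], namely
    [u = h \o iter (j - i).-1 S]. *)
Let corr i j : (i < j)%N -> \int[nu]_x (h (iter i S x) * h (iter j S x))%:E = 0.
Proof.
move=> ij; have hk : square_integrable nu (h \o iter (j - i).-1 S) by exact: square_integrable_iter.
have hP n x y : P n x -> P n y -> h x = h y.
  by move=> Px Py; rewrite /h (gP Px Py).
have hk0 : \int[nu]_x (h (iter (j - i).-1 S x))%:E = 0.
  by rewrite (integral_iter _ (f := EFin \o h))//; apply/measurable_EFinP; exact: h2.1.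
have := integral_factor_centered h2 hk hP hk0 => /= E0.
pose f x := (h x * h (iter (j - i).-1 S (S x)))%:E.
rewrite -E0 -(integral_iter i (f := f)).
  apply: eq_integral => x _; rewrite /f -iterSr prednK ?subn_gt0// -iterD subnK//.
  exact: ltnW.
exact: (measurable_int _ (square_integrableM h2 (square_integrable_iter 1 hk))).
Qed.

Let var i : \int[nu]_x (h (iter i S x) * h (iter i S x))%:E = sigma2%:E.
Proof.
rewrite (integral_iter i (f := fun x => (h x * h x)%:E)).
  rewrite /sigma2 /Rintegral fineK//.
  exact: (integrable_fin_num _ h2.2).
exact: (measurable_int _ (square_integrableM h2 h2)).
Qed.

Context (a : nat -> nat) (a_incr : increasing_pos_seq a).

Let Z n x := ((\sum_(i < n) h (iter (a i.+1).-1 S x)) / n%:R)%R.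

Let ZE n : (0 < n)%N -> \int[nu]_x (Z n x ^+ 2)%:E = (sigma2 / n%:R)%:E.
Proof.
move=> n0.
have hi i : square_integrable nu (h \o iter (a i.+1).-1 S) by exact: square_integrable_iter.
have hij i j := square_integrableM (hi i) (hi j).
have -> : (fun x => (Z n x ^+ 2)%:E) = (fun x => (n%:R ^- 2)%:E *
    \sum_(i < n) \sum_(j < n) (h (iter (a i.+1).-1 S x) * h (iter (a j.+1).-1 S x))%:E).
  apply/funext => x; rewrite /Z exprMn expr2 big_distrlr/= mulrC EFinM -exprVn.
  congr (_ * _); rewrite -sumEFin; apply: eq_bigr => i _.
  by rewrite -sumEFin.
rewrite integralZl//; last first.
  by apply: integrable_sum => // i _; apply: integrable_sum => // j _; exact: hij.
rewrite integral_sum//; last by move=> i; apply: integrable_sum => // j _; exact: hij.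
have corr0 (i j : 'I_n) : i != j ->
    \int[nu]_x (h (iter (a i.+1).-1 S x) * h (iter (a j.+1).-1 S x))%:E = 0.
  (* Positivity of [a] keeps the exponents [(a k).-1] distinct under truncated subtraction. *)
  have lt (k l : 'I_n) : (k < l)%N -> ((a k.+1).-1 < (a l.+1).-1)%N.
    move=> kl; have := a_incr.2 k.+1 l.+1 isT kl; have := a_incr.1 k.+1 isT.
    by case: (a k.+1) (a l.+1) => // ? [].
  rewrite neq_ltn => /orP[/lt ij|/lt ij]; first exact: corr.
  under eq_integral do rewrite mulrC.
  exact: corr.
rewrite (eq_bigr (fun=> sigma2%:E)) => [|i _]; last first.
  rewrite integral_sum//; last by move=> j; exact: hij.
  rewrite (bigD1 i)//= var big1 ?adde0// => j ij.
  by rewrite corr0// eq_sym.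
rewrite sumEFin -EFinM sumr_const card_ord -mulr_natr; congr (_%:E).
by field; rewrite pnatr_eq0 -lt0n.
Qed.

(** The index [n.+1] avoids the empty average. Fatou bounds the integral of this nonnegative lower
    limit by the limit of [sigma2 / n.+1]. *)
Lemma ae_liminf_average : {ae nu, forall x, limn_einf (fun n => (Z n.+1 x ^+ 2)%:E) = 0}.
Proof.
have mZ n : measurable_fun setT (fun x => (Z n.+1 x ^+ 2)%:E).
  apply/measurable_EFinP; apply: measurable_funX; apply: measurable_funM => //.
  apply: measurable_sum => i; exact: (square_integrable_iter _ h2).1.
have Z0 n x : [set: X] x -> 0 <= (Z n.+1 x ^+ 2)%:E by move=> _; rewrite lee_fin sqr_ge0.
have := fatou nu measurableT mZ Z0.
under [X in _ <= limn_einf X]funext do rewrite ZE//.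
have sigma_cvg : (sigma2 / n.+1%:R)%:E @[n --> \oo] --> 0.
  apply: cvg_EFin; first by near=> n.
  rewrite -[0%R](mulr0 sigma2); apply: cvgM; first exact: cvg_cst.
  exact: cvg_harmonic.
rewrite (cvg_limn_einf_sup sigma_cvg).1 => le0.
have ge0 x : 0 <= limn_einf (fun n => (Z n.+1 x ^+ 2)%:E).
  rewrite limn_einf_lim; apply: lime_ge; first exact: is_cvg_einfs.
  by near=> n; apply: le_ereal_inf_tmp => _ [k /= nk <-]; rewrite lee_fin sqr_ge0.
have mlim : measurable_fun setT (fun x => limn_einf (fun n => (Z n.+1 x ^+ 2)%:E)).
  rewrite (_ : (fun _ => _) = -%E \o (fun x => limn_esup (fun n => - (Z n.+1 x ^+ 2)%:E))).
    apply: measurableT_comp => //.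
    by apply: measurable_fun_limn_esup => n; exact: (measurableT_comp _ (mZ n)).
  apply/funext => x /=; rewrite -limn_einfN; congr limn_einf.
  by apply/funext => n /=; rewrite opprK.
have /(ae_eq_integral_abs nu measurableT mlim) :
    \int[nu]_x `|limn_einf (fun n => (Z n.+1 x ^+ 2)%:E)| = 0.
  under eq_integral do rewrite gee0_abs//.
  by apply/eqP; rewrite eq_le le0 integral_ge0.
by apply: filterS => x /(_ Logic.I).
Unshelve. all: by end_near.
Qed.

(** Where the averages converge, the lower limit of the squared deviations is the squared deviation
    of their limit. *)
Lemma ae_average_cvg : {ae nu, forall x,
    cvgn (fun n => ((\sum_(1 <= j < n.+1) g (iter (a j).-1 S x)) / n%:R)%R)} ->
  {ae nu, forall x,
    ((\sum_(1 <= j < n.+1) g (iter (a j).-1 S x)) / n%:R)%R @[n --> \oo] --> mean}.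
Proof.
move=> cv; have := ae_liminf_average; apply: filterS2 cv => x cv lim0.
set u := (fun n : nat => _) in cv *.
have ZE' n : Z n.+1 x = (u n.+1 - mean)%R.
  rewrite /Z /u /h sumrB sumr_const card_ord mulrBl -[(mean *+ _)%R]mulr_natr mulfK ?pnatr_eq0//.
  by rewrite big_add1/= big_mkord.
have ucv := cv; set l := limn u in ucv.
suff -> : mean = l by [].
have Zcv : Z n.+1 x @[n --> \oo] --> (l - mean)%R.
  under eq_fun do rewrite ZE'.
  by apply: cvgB; [move: ucv; rewrite -cvg_shiftS|exact: cvg_cst].
have Z2 : (Z n.+1 x ^+ 2)%:E @[n --> \oo] --> ((l - mean) ^+ 2)%:E.
  apply: cvg_EFin; first by near=> n.
  by rewrite expr2; under eq_fun do rewrite expr2; exact: cvgM.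
move: lim0; rewrite (cvg_limn_einf_sup Z2).1 => -[] /eqP.
by rewrite sqrf_eq0 subr_eq0 => /eqP.
Unshelve. all: by end_near.
Qed.

End IndependentFactor.

(** * Continuity of the inverse function *)

Section InverseFunction.
Context (R : realType) (F : R -> R).
Context (F_incr : forall x y : R, 0 <= x -> x < y -> F x < F y).
Context (F_avg : generalized_average_defined F).

Lemma incr_le (x y : R) : 0 <= x -> x <= y -> F x <= F y.
Proof. by move=> x0; rewrite le_eqVlt => /predU1P[->//|/(F_incr x0)/ltW]. Qed.

Lemma incr_lt_rev (x y : R) : 0 <= y -> F x < F y -> x < y.
Proof. by move=> y0; rewrite !ltNge; apply: contra => /(incr_le y0). Qed.

Lemma inverse_funK (x : R) : 0 <= x -> inverse_fun F (F x) = x.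
Proof.
move=> x0; apply: pinvKV; rewrite ?inE// => a b; rewrite !inE => a0 b0 ab.
apply/eqP; rewrite eq_le !leNgt; apply/andP; split; apply/negP.
  by move=> /(F_incr b0); rewrite ab ltxx.
by move=> /(F_incr a0); rewrite ab ltxx.
Qed.

(* The averages of copies of [F x] and [F y] are dense between [F x] and [F y]. *)
Lemma average_dense (x y s t : R) : 0 <= x -> x < y -> F x <= s -> s < t -> t <= F y ->
  exists2 z, 0 <= z & s < F z < t.
Proof.
move=> x0 xy xs st ty; have Fxy := F_incr x0 xy.
set u := F x in xs Fxy *; set w := F y in ty Fxy *.
have wu : 0 < w - u by rewrite subr_gt0.
have ts : 0 < t - s by rewrite subr_gt0.
(* Averages of [k] copies of [w] and [n - k] copies of [u] advance in steps of [(w - u) / n], here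
   shorter than [t - s]. *)
pose n := (Num.bound ((w - u) / (t - s))).+1.
have nP : (w - u) / n%:R < t - s.
  rewrite ltr_pdivrMr ?ltr0n// mulrC -ltr_pdivrMr//.
  apply: lt_le_trans (archi_boundP _) _; first by rewrite divr_ge0 ?ltW.
  by rewrite ler_nat.
have n0 : 0 < n%:R :> R by rewrite ltr0n.
pose q := (s - u) * n%:R / (w - u).
have q0 : 0 <= q by rewrite divr_ge0 ?mulr_ge0 ?subr_ge0 ?(ltW wu) ?(ltW n0) ?(ltW Fxy).
(* The first point of this grid beyond [s]. *)
pose k := (Num.truncn q).+1.
have /andP[kq qk] := truncn_itv q0.
have s_lt : s < u + k%:R * (w - u) / n%:R.
  by rewrite -ltrBlDl ltr_pdivlMr// -ltr_pdivrMr.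
have lt_t : u + k%:R * (w - u) / n%:R < t.
  have kq' : k%:R <= q + 1 by rewrite /k -natr1 lerD2r.
  apply: (@le_lt_trans _ _ (s + (w - u) / n%:R)); last by rewrite -ltrBrDl.
  have -> : s + (w - u) / n%:R = u + (q + 1) * (w - u) / n%:R.
    by rewrite /q; field; rewrite !gt_eqF.
  by rewrite lerD2l ler_wpM2r ?invr_ge0 ?(ltW n0)// ler_wpM2r// ltW.
have kn : (k <= n)%N.
  rewrite -(ler_nat R) -(ler_pM2r wu) -(ler_pM2r (_ : 0 < n%:R^-1)) ?invr_gt0//.
  rewrite -(lerD2l u); apply: ltW; apply: lt_le_trans lt_t _.
  by apply: le_trans ty _; rewrite mulrAC divff ?gt_eqF// mul1r subrKC.
have [|z z0 zE] := @F_avg n (fun j => if (j <= k)%N then y else x) isT.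
  by move=> j; case: ifP => // _; apply: le_trans (ltW xy).
exists z => //; rewrite zE.
suff -> : average F n (fun j => if (j <= k)%N then y else x) = u + k%:R * (w - u) / n%:R.
  by rewrite s_lt.
rewrite /average (big_cat_nat (n := k.+1))//=.
rewrite (eq_big_nat _ _ (F2 := fun=> w)) => [|i /andP[_ ik]]; last by rewrite ifT.
rewrite [X in _ + X](eq_big_nat _ _ (F2 := fun=> u)) => [|i /andP[ki _]]; last first.
  by rewrite ifF//; apply/negbTE; rewrite -ltnNge.
rewrite !sumr_const_nat subn1 subSS/= -[w *+ k]mulr_natr -[u *+ _]mulr_natr natrB//.
by field; rewrite gt_eqF.
Qed.

(** If [F] missed [m] at [z = sup S], its image would have a gap next to [m], against
    [average_dense]. *)
Lemma incr_ivt (m b : R) : F 0 <= m -> m < F b -> 0 <= b -> exists2 z, 0 <= z & F z = m.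
Proof.
move=> m0 mb b0; pose S := [set x | 0 <= x /\ F x <= m].
have S0 : S 0 by split.
have Sb : ubound S b.
  by move=> x [x0 xm]; apply/ltW/(incr_lt_rev b0)/le_lt_trans/mb.
have supS : has_sup S by split; [exists 0|exists b].
pose z := sup S; have z0 : 0 <= z by apply: ub_le_sup => //; exists b.
have zb : z <= b by apply: ge_sup => //; exists 0.
exists z => //; case: (ltgtP (F z) m) => // h.
- have zb' : z < b by apply: incr_lt_rev => //; exact: lt_trans mb.
  have [y y0 /andP[zy ym]] := average_dense z0 zb' (lexx _) h (ltW mb).
  have : y <= z by apply: ub_le_sup; [exists b|split => //; exact: ltW].
  by rewrite leNgt (incr_lt_rev y0 zy).
- have zpos : 0 < z by apply: incr_lt_rev => //; exact: le_lt_trans h.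
  have [y y0 /andP[my yz]] := average_dense (lexx 0) zpos m0 h (lexx _).
  have yz' := incr_lt_rev z0 yz.
  have zy0 : 0 < z - y by rewrite subr_gt0.
  have [x [x0 xm] yx] := sup_adherent zy0 supS.
  move: yx; rewrite subKr => yx.
  by have := lt_trans my (F_incr y0 yx); rewrite ltNge xm.
Qed.

(** The hypothesis skips [y 0]: the empty average is 0, which need not be a value of [F]. *)
Lemma inverse_fun_cvg (y : nat -> R) (z : R) : 0 <= z ->
  (forall n, (F @` @nonneg_reals R) (y n.+1)) ->
  y n @[n --> \oo] --> F z -> inverse_fun F (y n) @[n --> \oo] --> z.
Proof.
move=> z0 yF yz; rewrite -cvg_shiftS; rewrite -cvg_shiftS/= in yz.
apply/cvgrPdist_lt => eps eps0.
have ub : \forall n \near \oo, y n.+1 < F (z + eps).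
  by apply: (cvgr_lt _ yz); apply: F_incr; rewrite ?ltrDl.
(* [F] is increasing only on the nonnegative reals; if [z - eps < 0], the lower bound comes from
   [x >= 0] instead. *)
have lb : \forall n \near \oo, 0 <= z - eps -> F (z - eps) < y n.+1.
  have [ze|ze] := leP 0 (z - eps); last by near=> n.
  have : \forall n \near \oo, F (z - eps) < y n.+1.
    by apply: (cvgr_gt _ yz); apply: F_incr; rewrite ?ltrBlDr ?ltrDl.
  by apply: filterS.
apply: filterS2 ub lb => n ub lb.
have [x x0 xE] := yF n; rewrite /nonneg_reals/= in x0.
rewrite /= -xE inverse_funK//; rewrite -xE in ub lb.
have xu : x < z + eps by apply: (incr_lt_rev _ ub); rewrite addr_ge0// ltW.
have xl : z - eps < x.
  have [ze|ze] := leP 0 (z - eps); last exact: lt_le_trans ze x0.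
  exact: (incr_lt_rev x0 (lb ze)).
by rewrite ltr_norml; lra.
Unshelve. all: by end_near.
Qed.

End InverseFunction.

(** * Means on a probability space *)

Section ProbabilityIntegral.
Context d (X : measurableType d) (R : realType).

Lemma restriction_probability (mu : {measure set X -> \bar R}) (D : set X) :
  measurable D -> mu D = 1%E ->
  exists nu : probability X R, forall A, nu A = mu (A `&` D).
Proof.
move=> mD muD; pose nu := mrestr mu mD.
have nu1 : nu setT = 1%E by rewrite /nu /mrestr setTI.
pose isP := Measure_isProbability.Build _ _ _ nu nu1.
pose P : probability X R := HB.pack nu isP.
by exists P.
Qed.

Context (nu : probability X R) (g : X -> R) (gi : nu.-integrable setT (EFin \o g)).
Local Open Scope ereal_scope.

Let integral_cstE (c : R) : \int[nu]_(x in setT) c%:E = c%:E.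
Proof. by rewrite integral_cst// -[RHS]mule1; congr (_ * _); exact: probability_setT. Qed.

Let meanE : (\int[nu]_x g x)%R%:E = \int[nu]_x (g x)%:E.
Proof. by rewrite /Rintegral fineK//; exact: integrable_fin_num gi. Qed.

Lemma Rintegral_ge_cst (c : R) : (forall x, c <= g x)%R -> (c <= \int[nu]_x g x)%R.
Proof.
move=> cg; rewrite -lee_fin meanE -integral_cstE.
by apply: le_integral => //; [exact: finite_measure_integrable_cst|move=> x _; rewrite lee_fin].
Qed.

(** With equality, the positive function [c - g] would have integral 0 and so vanish almost
    everywhere on a space of mass 1. *)
Lemma Rintegral_lt_cst (c : R) : (forall x, g x < c)%R -> (\int[nu]_x g x < c)%R.
Proof.
move=> gc; rewrite lt_neqAle; apply/andP; split; last first.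
  rewrite -lee_fin meanE -[leRHS]integral_cstE; apply: le_integral => //.
    exact: finite_measure_integrable_cst.
  by move=> x _; rewrite lee_fin ltW.
apply/eqP => E.
have ci : nu.-integrable setT (fun=> c%:E) by exact: finite_measure_integrable_cst.
have cgi := integrableB measurableT ci gi.
have : \int[nu]_x `|((fun=> c%:E) \- (EFin \o g)) x| = 0.
  rewrite (eq_integral ((fun=> c%:E) \- (EFin \o g))); last first.
    by move=> x _; rewrite gee0_abs//= lee_fin subr_ge0 ltW.
  rewrite integralB// -meanE E; transitivity (c%:E - c%:E); last by rewrite subee.
  by congr (_ - _); exact: integral_cstE.
move=> /(ae_eq_integral_abs _ measurableT (measurable_int _ cgi)) [N [mN N0 sub]].
have : nu setT <= nu N.
  apply: le_measure; rewrite ?inE// => x _; apply: sub => /= /(_ Logic.I) [] /eqP.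
  by rewrite subr_eq0 gt_eqF.
have -> : nu setT = 1 by exact: probability_setT.
by rewrite [nu N]N0 leNgt lte01.
Qed.

End ProbabilityIntegral.

(** * Convergence of the generalized averages *)

Theorem proposition20 (R : realType) (p : nat) (p_prime : prime p)
  (Qp : fieldType) (vQ : absval Qp R) (QpP : is_padic_field p vQ)
  (K : fieldExtType Qp) (v : absval K R)
  (v_ext : forall x : Qp, v x%:A = vQ x)
  (e f : nat) (eP : ramification_index vQ v {:K}%AS e)
  (fP : residue_degree vQ v f)
  (L : {subfield K}) (L_unram : unramified vQ v L) (L_deg : \dim L = f)
  (gamma beta : K)
  (gamma_root : (p ^ f - 1)%N.-primitive_root gamma)
  (L_gamma : (L : {vspace K}) = <<1; gamma>>%VS)
  (K_beta : <<L; beta>>%VS = {:K}%VS)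
  (beta_abs : v beta = p%:R `^ (e%:R^-1))
  (mu : {measure set (borel v) -> \bar R}) (mu_haar : is_haar mu)
  (mu1 : mu (unit_ball v) = 1%E)
  (F : R -> R)
  (F_incr : forall x y : R, 0 <= x -> x < y -> F x < F y)
  (F_avg : generalized_average_defined F)
  (F_L2 : (\int[mu]_(alpha in unit_ball v)
      (`|F (v (partial_quotient p vQ e f gamma beta 1 alpha))| ^+ 2)%:E
      < +oo)%E)
  (a : nat -> nat) (a_good : L2_good_universal R a)
  (a_ud : forall theta : R, irrational theta ->
    unif_distr_mod1 (fun n => (a n)%:R * theta)) :
  {ae mu, forall alpha : borel v, unit_ball v alpha ->
    generalized_average F n
      (fun j => v (partial_quotient p vQ e f gamma beta (a j) alpha))
      @[n --> \oo] -->
    inverse_fun F (\int[mu]_(x in unit_ball v)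
      F (v (partial_quotient p vQ e f gamma beta 1 x)))%R}.
Proof.
set fl := @field_floor p Qp R vQ K e f gamma beta.
have vU : ultrametric v := absval_ext_ultra p_prime QpP v_ext.
have fl_sub x : v (x - fl x) < 1.
  exact: (field_floor_sub p_prime QpP v_ext eP fP gamma_root beta_abs).
have fl_uniq x y : v (fl x - fl y) < 1 -> fl x = fl y.
  exact: (field_floor_uniq p_prime QpP v_ext eP fP gamma_root beta_abs).
have fl_cnt : countable (range fl).
  exact: (countable_field_floor p_prime QpP v_ext eP fP gamma_root beta_abs).
have beta1 : 1 < v beta := absval_beta_gt1 p_prime eP beta_abs.
case: mu_haar => mu_trans _ _.
have [P [mP tP UP PS Pfl]] :=
  floor_map_partition vU fl_sub fl_uniq fl_cnt beta1 mu_trans mu1.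
have mT := measurable_floor_map vU fl_sub fl_uniq.
set T := floor_map fl in PS mT.
have mB : measurable (unit_ball v : set (borel v)) := measurable_unit_ball vU.
(* The dynamical system is all of [K] with a probability concentrated on the unit ball, which avoids
   a subtype. *)
have [nu nuE] := restriction_probability mB mu1.
have nuT A : measurable A -> nu (T @^-1` A) = nu A.
  by move=> mA; rewrite !nuE (measure_floor_map vU fl_sub fl_uniq fl_cnt beta1 mu_trans mu1).
have PB n : P n `<=` unit_ball v by rewrite -UP; exact: bigcup_sup.
have nuP1 : nu (\bigcup_n P n) = 1%E by rewrite nuE UP setIid mu1.
have nuPS n B : measurable B -> nu (P n `&` T @^-1` B) = (nu (P n) * nu B)%E.
  by move=> mB'; rewrite !nuE setIAC (setIidl (PB n)) PS.
(* By conversion, [F] of the absolute value of the [n]-th partial quotient is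
   [G (iter n.-1 T alpha)]. *)
pose G (x : borel v) : R := F (v (fl (x : K)^-1)).
have mG : measurable_fun setT G.
  move=> _ B mB'; rewrite setTI.
  exact: (measurable_floor_fiber vU fl_sub fl_uniq (fun z => B (F (v z)))).
have nu_int (h : borel v -> \bar R) : measurable_fun setT h ->
    (\int[nu]_x h x = \int[mu]_(x in unit_ball v) h x)%E.
  move=> mh; rewrite -(integral_mrestr mu mB mh).
  by apply: eq_measure_integral => A mA _; exact: nuE.
have mG2 : measurable_fun setT (fun x => (G x ^+ 2)%:E).
  by apply/measurable_EFinP; exact: measurable_funX.
have G2 : square_integrable nu G.
  split => //; apply/integrableP; split => //.
  under eq_integral do rewrite gee0_abs ?lee_fin ?sqr_ge0//.
  rewrite nu_int//; apply: le_lt_trans F_L2.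
  rewrite le_eqVlt; apply/orP; left; apply/eqP; apply: eq_integral => x _.
  by rewrite real_normK ?num_real.
pose Gm : {mfun borel v >-> R} :=
  MeasurableFun.Pack (MeasurableFun.Class (isMeasurableFun.Build _ _ _ _ G mG)).
have GP n x y : P n x -> P n y -> Gm x = Gm y.
  by move=> Px Py; rewrite /= /G (Pfl n x y).
have Gi := square_integrable_integrable G2.
have Gfin : finite_norm nu 2%:E Gm.
  rewrite /finite_norm unlock; apply: poweR_lty.
  case/integrableP: (G2.2) => _; apply: le_lt_trans.
  rewrite le_eqVlt; apply/orP; left; apply/eqP; apply: eq_integral => x _ /=.
  by rewrite powR_mulrn// real_normK ?num_real// ger0_norm ?sqr_ge0.
case: a_good => a_incr a_cvg.
have cv := a_cvg _ _ nu T mT nuT Gm Gfin.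
have := ae_average_cvg (g := Gm) mT nuT mP tP nuP1 nuPS G2 GP a_incr cv.
set mean := (\int[nu]_x Gm x)%R.
have meanE : mean = (\int[mu]_(x in unit_ball v)
    F (v (partial_quotient p vQ e f gamma beta 1 x)))%R.
  by rewrite /mean /Rintegral nu_int//; apply/measurable_EFinP.
have F0 : F 0 <= mean.
  by apply: (Rintegral_ge_cst Gi) => x; apply: (incr_le F_incr) => //; exact: absval_ge0.
(* If [mean] bounded [F] from above, strict monotonicity would give [G < mean] everywhere, which is
   impossible for a mean. *)
have [b b0 mb] : exists2 b, 0 <= b & mean < F b.
  apply: contrapT => nb; have Fm x : 0 <= x -> F x <= mean.
    by move=> x0; rewrite leNgt; apply/negP => xm; apply: nb; exists x.
  have : mean < mean.
    apply: (Rintegral_lt_cst Gi) => x; apply: lt_le_trans (Fm (v (fl (x : K)^-1) + 1) _).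
      by apply: F_incr; [exact: absval_ge0|rewrite ltrDl].
    by rewrite addr_ge0// absval_ge0.
  by rewrite ltxx.
have [z z0 Fz] := incr_ivt F_incr F_avg F0 mb b0.
rewrite -meanE -Fz (inverse_funK F_incr z0) => -[N [mN N0 sub]].
(* [nu N = 0] controls only the part of [N] in the unit ball, where alone something is claimed. *)
exists (N `&` unit_ball v); split.
- exact: measurableI.
- by rewrite -nuE.
move=> x /not_implyP[x1 ncv]; split => //; apply: sub => /= cx; apply: ncv.
apply: (inverse_fun_cvg F_incr z0) => [n|].
  by apply: F_avg => // j; exact: absval_ge0.
exact: cx.
Qed.
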